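(* Let $n\ge5$. There is a projective homeomorphism $$\pi\colon|\operatorname{dl}(S^{\Diamond},\bar{\mathcal{C}}(P^{\vartriangle}))|\to|\operatorname{dl}(N,S^{\vartriangle})|$$ which induces a combinatorial equivalence between the polyhedral complex $\operatorname{dl}(S^{\Diamond},\bar{\mathcal{C}}(P^{\vartriangle}))$ and the rotation complex $\mathcal{S}$.
   Context: Fix an integer $n\ge5$. Let $V_n=\{1,\dots,n\}$ and let $E_n$ be the set of all two-element subsets $uv:=\{u,v\}$ of $V_n$. Write $x\cdot y$ for the standard inner product on $\mathbb{R}^{E_n}$ and $\chi^F\in\{0,1\}^{E_n}$ for the characteristic vector of $F\subset E_n$. Polyhedra. $S\subset\mathbb{R}^{E_n}$ is the Symmetric Traveling Salesman Polytope, i.e. the convex hull of all $\chi^{E(C)}$, where $C$ ranges over the cycles with vertex set $V_n$ (Hamilton cycles of $K_n$). $P\subset\mathbb{R}^{E_n}$ is the Graphical Traveling Salesman Polyhedron, i.e. the convex hull of all $x\in\mathbb{Z}_+^{E_n}$ such that the multigraph on vertex set $V_n$ with $x_e$ copies of each edge $e$ is connected and Eulerian (all degrees even). It is known that $S$ is a face of $P$. Polar of $S$. For $u\in V_n$, $\delta_u\in\mathbb{R}^{E_n}$ has entry $1/2$ on all edges incident to $u$ and $0$ elsewhere. Let $L:=\{x\in\mathbb{R}^{E_n}\mid \delta_u\cdot x=0\ \forall u\in V_n\}$; its orthogonal complement $L^\perp$ is the span of the $\delta_u$. Let $z:=\frac{2}{n-1}\mathbf{1}$ (a relative interior point of $S$)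 and $$S^{\vartriangle}:=\{a\in L\mid (-a)\cdot(x-z)\le1\ \ \forall x\in S\}.$$ A point $a\in S^{\vartriangle}$ corresponds to the inequality $a\cdot x\ge a\cdot z-1$ valid for $S$; vertices of $S^{\vartriangle}$ correspond to facets of $S$. For $n\ge5$ every inequality $x_e\ge0$ defines a facet of $S$; let $N$ be the set of the vertices of $S^{\vartriangle}$ corresponding to these facets, i.e. the vertices $a$ with $\{x\in S\mid a\cdot x=a\cdot z-1\}=\{x\in S\mid x_e=0\}$ for some $e\in E_n$. Polar of $P$. $P^{\vartriangle}:=\{a\in\mathbb{R}^{E_n}\mid a\cdot x\ge1\ \forall x\in P\}$, and $S^{\Diamond}:=\{a\in P^{\vartriangle}\mid a\cdot x=1\ \forall x\in S\}$ is the face of $P^{\vartriangle}$ conjugate to $S$. Polyhedral complexes. A polyhedral complex is a (finite) set of polyhedra closed under taking faces such that the intersection of any two members is a face of both; $|\mathcal{C}|$ denotes the union of the members of $\mathcal{C}$. The empty polyhedron is disregarded when comparing complexes. $\bar{\mathcal{C}}(P^{\vartriangle})$ is the complex of all bounded faces of $P^{\vartriangle}$. The complex $\operatorname{dl}(S^{\Diamond},\bar{\mathcal{C}}(P^{\vartriangle}))$ consists of all bounded faces $F$ of $P^{\vartriangle}$ with $F\cap S^{\Diamond}=\emptyset$. The complex $\operatorname{dl}(N,S^{\vartriangle})$ consists of all faces $F$ of $S^{\vartriangle}$ with $F\cap N=\emptyset$. A map $f\colon|\mathcal{C}|\to|\mathcal{D}|$ induces a combinatorial equivalence between $\mathcal{C}$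 and $\mathcal{D}$ if for every $F\in\mathcal{C}$ the image $f(F)$ is a polyhedron and the set of all these images equals $\mathcal{D}$; the complexes are then combinatorially equivalent (there is an inclusion-preserving bijection of faces) via $F\mapsto f(F)$. Projective maps. A map $f$ between (subsets of) vector spaces $L_1,L_2$ is projective if there are a real $f_{00}$, a linear functional $f_{01}\colon L_1\to\mathbb{R}$, a vector $f_{10}\in L_2$ and a linear map $f_{11}\colon L_1\to L_2$ with $f(x)=\frac{f_{10}+f_{11}(x)}{f_{00}+f_{01}(x)}$, the denominator being nonzero on the domain. Rotation complex. For $a\in|\operatorname{dl}(N,S^{\vartriangle})|$, let $\mathfrak{F}(a)$ be the set of all faces $F$ of $P$ for which there exists $q\in L^\perp$ such that the inequality $(a+q)\cdot x\ge a\cdot z-1+q\cdot z$ is valid for $P$ and $F=\{x\in P\mid (a+q)\cdot x=a\cdot z-1+q\cdot z\}$. Partition $|\operatorname{dl}(N,S^{\vartriangle})|$ by putting $a,b$ in the same cell if and only if $\mathfrak{F}(a)=\mathfrak{F}(b)$. The rotation complex $\mathcal{S}$ is the set of the topological closures of the cells of this partition (it is a polyhedral complex). *)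

(* Defs.v *)
From HB Require Import structures.
From mathcomp Require Import all_boot all_order all_algebra.
From mathcomp Require Import all_classical all_reals all_analysis.
Import Order.TTheory GRing.Theory Num.Theory.
Import numFieldNormedType.Exports.

Set Implicit Arguments.
Unset Strict Implicit.
Unset Printing Implicit Defensive.

Local Open Scope classical_set_scope.
Local Open Scope ring_scope.

Section Polyhedra.
Context {R : realType} {d : nat}.
Implicit Types (x y c : 'rV[R]_d) (A Q F : set 'rV[R]_d)
  (C D : set (set 'rV[R]_d)).

Definition dot x y : R := \sum_i x ord0 i * y ord0 i.

Definition convex_hull A : set 'rV[R]_d :=
  [set x | exists (k : nat) (w : 'I_k -> R) (p : 'I_k -> 'rV[R]_d),
    [/\ forall i, 0 <= w i, \sum_i w i = 1, forall i, A (p i)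
      & x = \sum_i w i *: p i]].

Definition polyhedron Q : Prop :=
  exists (m : nat) (c : 'I_m -> 'rV[R]_d) (b : 'I_m -> R),
    Q = [set x | forall i, b i <= dot (c i) x].

Definition valid c (b : R) Q : Prop := forall x, Q x -> b <= dot c x.

(* The trivial inequalities [c = 0] are allowed, so that [Q] itself and the
   empty set are faces of [Q]. *)
Definition face Q F : Prop :=
  exists (c : 'rV[R]_d) (b : R), valid c b Q /\ F = [set x | Q x /\ dot c x = b].

Definition vertex Q x : Prop := face Q [set x].

Definition face_complex Q : set (set 'rV[R]_d) := [set F | face Q F].

Definition bounded_complex Q : set (set 'rV[R]_d) :=
  [set F | face Q F /\ bounded_set F].

Definition carrier C : set 'rV[R]_d := \bigcup_(F in C) F.

Definition deletion A C : set (set 'rV[R]_d) :=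
  [set F | C F /\ F `&` A = set0].

(* The empty polyhedron is disregarded in the comparison of [C] and [D]. *)
Definition induces_comb_equiv (f : 'rV[R]_d -> 'rV[R]_d) C D : Prop :=
  (forall F, C F -> polyhedron (f @` F)) /\
  [set f @` F | F in C] `\ set0 = D `\ set0.

End Polyhedra.

Definition projective_on {R : realType} {V W : lmodType R} (A : set V)
    (f : V -> W) : Prop :=
  exists (f00 : R) (f01 : {scalar V}) (f10 : W) (f11 : {linear V -> W}),
    forall x, A x ->
      f00 + f01 x != 0 /\ f x = (f00 + f01 x)^-1 *: (f10 + f11 x).

(* [f] is total; only its restriction to [A] is considered. *)
Definition homeomorphism_on {T U : topologicalType} (A : set T) (B : set U)
    (f : T -> U) : Prop :=
  [/\ set_bij A B f, {within A, continuous f}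
    & exists g : U -> T, {in A, cancel f g} /\ {within B, continuous g}].

(* Edges of the complete graph with vertex set ['I_n]. *)
Notation edge n := {e : {set 'I_n} | #|e| == 2%N}.

(* The real vectors indexed by the edges; the coordinate [x_e] is
   [x ord0 (enum_rank e)]. *)
Notation edge_space R n := 'rV[R]_#|{: edge n}|.

Section TSP.
Context (R : realType) (n : nat).
Implicit Types (e : edge n) (u v : 'I_n) (x a b q : edge_space R n).

Definition coord x e : R := x ord0 (enum_rank e).

Definition edge_vec (f : edge n -> R) : edge_space R n :=
  \row_i f (enum_val i).

Definition char_vec (F : {set edge n}) : edge_space R n :=
  edge_vec (fun e => (e \in F)%:R).

(* A Hamilton cycle is given by listing each vertex once, in cyclic order. *)
Definition hamilton_cycle (c : seq 'I_n) : Prop :=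
  uniq c /\ (forall u, u \in c).

Definition cycle_edges (c : seq 'I_n) : {set edge n} :=
  [set e : edge n | [exists u, (u \in c) && (val e == [set u; next c u]%SET)]]%SET.

Definition STSP : set (edge_space R n) :=
  convex_hull
    [set x | exists c, hamilton_cycle c /\ x = char_vec (cycle_edges c)].

Definition multigraph_connected (m : edge n -> nat) : Prop :=
  forall u v, connect
    (fun s t => [exists e : edge n, (0 < m e)%N && (val e == [set s; t]%SET)]) u v.

Definition multigraph_eulerian (m : edge n -> nat) : Prop :=
  forall u, ~~ odd (\sum_(e : edge n | u \in val e) m e)%N.

Definition GTSP : set (edge_space R n) :=
  convex_hull
    [set x | exists m : edge n -> nat, [/\ multigraph_connected m,
       multigraph_eulerian m & x = edge_vec (fun e => (m e)%:R)]].

Definition delta u : edge_space R n :=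
  edge_vec (fun e => if u \in val e then 2^-1 else 0).

Definition Lspace : set (edge_space R n) :=
  [set x | forall u, dot (delta u) x = 0].

Definition Lperp : set (edge_space R n) :=
  [set q | forall x, Lspace x -> dot q x = 0].

Definition zpoint : edge_space R n := const_mx (2 / (n%:R - 1)).

Definition STSP_polar : set (edge_space R n) :=
  [set a | Lspace a /\ forall x, STSP x -> dot (- a) (x - zpoint) <= 1].

(* The vertices of [STSP_polar] given by the nonnegativity facets of [STSP]. *)
Definition nonneg_vertices : set (edge_space R n) :=
  [set a | vertex STSP_polar a /\ exists e : edge n,
     [set x | STSP x /\ dot a x = dot a zpoint - 1] =
     [set x | STSP x /\ coord x e = 0]].

Definition GTSP_polar : set (edge_space R n) :=
  [set a | forall x, GTSP x -> 1 <= dot a x].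

Definition STSP_diamond : set (edge_space R n) :=
  [set a | GTSP_polar a /\ forall x, STSP x -> dot a x = 1].

Definition GTSP_deletion : set (set (edge_space R n)) :=
  deletion STSP_diamond (bounded_complex GTSP_polar).

Definition STSP_deletion : set (set (edge_space R n)) :=
  deletion nonneg_vertices (face_complex STSP_polar).

Definition rotation_faces a : set (set (edge_space R n)) :=
  [set F | face GTSP F /\ exists q, [/\ Lperp q,
     valid (a + q) (dot a zpoint - 1 + dot q zpoint) GTSP
   & F = [set x | GTSP x /\ dot (a + q) x = dot a zpoint - 1 + dot q zpoint]]].

Definition rotation_cell a : set (edge_space R n) :=
  [set b | carrier STSP_deletion b /\ rotation_faces b = rotation_faces a].

Definition rotation_complex : set (set (edge_space R n)) :=
  [set closure (rotation_cell a) | a in carrier STSP_deletion].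

End TSP.

Arguments zpoint : clear implicits.
Arguments Lspace : clear implicits.
Arguments Lperp : clear implicits.
Arguments STSP : clear implicits.
Arguments GTSP : clear implicits.
Arguments STSP_polar : clear implicits.
Arguments GTSP_polar : clear implicits.
Arguments STSP_diamond : clear implicits.
Arguments nonneg_vertices : clear implicits.
Arguments STSP_deletion : clear implicits.
Arguments GTSP_deletion : clear implicits.
Arguments rotation_complex : clear implicits.

(* Main.v *)
(** Write a vector [a] of the polar of [GTSP] as [p + q] with [p] in [Lspace] and
    [q] in the span of the [delta u].  The map is [a |-> p / (a . z - 1)].

    A bounded face of [GTSP_polar] missing [STSP_diamond] consists of points
    [a] whose tight connected Eulerian multigraphs use every edge and have, at
    every vertex, one of degree at least [4].  Replacing an edge [vw] by [vu, uw]
    gives the triangle inequality for [a]; removing one of two visits of [u] in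
    an Euler tour gives an equality [a_vw = a_uv + a_uw].  These conditions (tight
    triangular form) determine [q] from [p]: the coefficient of [delta u] is the
    maximum of [p_vw - p_uv - p_uw].  This inverts the map.  By shortcutting,
    validity for [GTSP] and for [STSP] agree for vectors obeying the triangle
    inequality, and the points of the image are those [b] with a tight tour
    through every edge, i.e. the points of the faces of [STSP_polar] avoiding
    the nonnegativity vertices.

    The valid [q] for [b] are the coefficientwise larger ones, so that the largest
    member of [rotation_faces b] is the set of points of [GTSP] tight at the preimage
    of [b].  A cell is therefore the image of the relative interior of a face, and
    its closure the image of the face. *)
Require Import Defs.
From HB Require Import structures.
From mathcomp Require Import all_boot all_order all_algebra all_fingroup.
From mathcomp Require Import all_classical all_reals all_analysis.
From mathcomp Require Import zify ring lra.
Import Order.TTheory GRing.Theory Num.Theory.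
Import numFieldNormedType.Exports.
(* [vector.coord] and others would otherwise shadow the notions of [Defs]. *)
Import Defs.

Set Implicit Arguments.
Unset Strict Implicit.
Unset Printing Implicit Defensive.

Local Open Scope ring_scope.


(** Both conditions on the points of a bounded face say that certain points cannot belong to it. If
    the tight multigraphs all missed an edge, the face would contain a ray in the direction of its
    unit vector; if they all had degree 2 at [u], it would contain [delta u], which lies in
    [STSP_diamond]. The denominator [a . z - 1] is positive because a functional equal to 1 on all
    tours is a combination of the [delta u], whereas a tight triangle at [u] makes the coefficient
    of [delta u] vanish. This, and the uniqueness of the vertex given by an edge, rest on
    2-exchanges between tours avoiding that edge, for which five vertices are needed. Facts on faces
    come from finite systems of inequalities instead of dimension counts. As the maximum defining
    the inverse is only piecewise linear, it takes the tight triangles shared by a whole face to see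
    that its image is a polyhedron. *)

(** * Coordinates of vectors indexed by edges *)

Section EdgeValues.
Context {R : realType} {n : nat}.
Implicit Types (e : edge n) (u v w : 'I_n) (a b : edge_space R n) (m : edge n -> nat).

(* The coordinate of the edge [uv], and [0] if [u = v]. *)
Definition ev a u v : R := \sum_(e : edge n | val e == [set u; v]%SET) coord a e.

Lemma ev_sym a u v : ev a u v = ev a v u.
Proof. by rewrite /ev finset.setUC. Qed.

Lemma evxx a u : ev a u u = 0.
Proof.
rewrite /ev big1// => -[e he] /= /eqP ee; exfalso.
by move: he; rewrite ee finset.setUid cards1.
Qed.

Lemma edge_ends e : exists u v, u != v /\ val e = [set u; v]%SET.
Proof. by case/cards2P: (valP e) => u [v [uv ee]]; exists u, v. Qed.

Lemma edge_of u v : u != v -> exists e : edge n, val e = [set u; v]%SET.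
Proof.
move=> uv; have h : #|[set u; v]%SET| == 2%N by rewrite cards2 uv.
by exists (exist (fun e : {set 'I_n} => is_true (#|e| == 2%N)) _ h).
Qed.

Lemma ev_edge a e u v : val e = [set u; v]%SET -> ev a u v = coord a e.
Proof.
move=> ee; rewrite /ev (big_pred1 e)// => f /=.
by rewrite -ee; apply/eqP/eqP => [/val_inj|->].
Qed.

Lemma coord_ext a b : (forall e, coord a e = coord b e) -> a = b.
Proof.
by move=> h; apply/rowP => i; have := h (enum_val i); rewrite /coord enum_valK.
Qed.

Lemma ev_ext a b : (forall u v, u != v -> ev a u v = ev b u v) -> a = b.
Proof.
move=> h; apply: coord_ext => e; have [u [v [uv ee]]] := edge_ends e.
by rewrite -!(ev_edge _ ee) h.
Qed.

Lemma coord_vec (f : edge n -> R) e : coord (edge_vec f) e = f e.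
Proof. by rewrite /coord mxE enum_rankK. Qed.

Lemma coordD a b e : coord (a + b) e = coord a e + coord b e.
Proof. by rewrite /coord mxE. Qed.

Lemma coordZ (k : R) a e : coord (k *: a) e = k * coord a e.
Proof. by rewrite /coord mxE. Qed.

Lemma evD a b u v : ev (a + b) u v = ev a u v + ev b u v.
Proof. by rewrite /ev -big_split; apply: eq_bigr => e _; rewrite coordD. Qed.

Lemma evZ (k : R) a u v : ev (k *: a) u v = k * ev a u v.
Proof. by rewrite /ev mulr_sumr; apply: eq_bigr => e _; rewrite coordZ. Qed.

Lemma ev_sum (I : Type) (s : seq I) (P : pred I) (F : I -> edge_space R n) u v :
  ev (\sum_(i <- s | P i) F i) u v = \sum_(i <- s | P i) ev (F i) u v.
Proof.
elim/big_rec2: _ => [|i y x _ <-]; last by rewrite evD.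
by rewrite /ev big1// => e _; rewrite /coord mxE.
Qed.

Lemma dot_coord a b : dot a b = \sum_(e : edge n) coord a e * coord b e.
Proof.
rewrite /dot (reindex (@enum_rank [the finType of edge n])) //=.
by exists enum_val => x _; rewrite ?enum_valK ?enum_rankK.
Qed.

Lemma sum_ev a u : \sum_v ev a u v = \sum_(e : edge n | u \in val e) coord a e.
Proof.
rewrite /ev (exchange_big_dep (fun e : edge n => u \in val e)) /=; last first.
  by move=> v e _ /eqP ->; rewrite set21.
apply: eq_bigr => e ue.
have [x [y [xy ee]]] := edge_ends e.
have [w ew] : exists w, val e = [set u; w]%SET.
  move: ue; rewrite ee => /finset.set2P[->|->]; first by exists y.
  by exists x; rewrite finset.setUC.
have uw : u != w.
  by have := valP e; rewrite /= ew cards2; case: (u != w).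
rewrite (big_pred1 w)// => v /=; rewrite ew; apply/eqP/eqP => [/setP h|->//].
by have := h w; rewrite !inE eqxx orbT eq_sym (negbTE uw) => /esym/= /eqP.
Qed.

Lemma sum_ev_delta a u : \sum_v ev a u v = dot (delta R u) a *+ 2.
Proof.
rewrite sum_ev dot_coord -sumrMnl [LHS]big_mkcond; apply: eq_bigr => e _.
by rewrite coord_vec; case: ifP => _; rewrite ?mul0r ?mul0rn//; field.
Qed.

Lemma ev_delta u v w : v != w -> ev (delta R u) v w = ((u == v) || (u == w))%:R / 2.
Proof.
move=> /edge_of[e ee]; rewrite (ev_edge _ ee) coord_vec ee !inE.
by case: ifP; rewrite ?mul0r ?mul1r.
Qed.

End EdgeValues.

(** * Closed walks and Euler's theorem *)

Definition steps (T : Type) (x : T) (p : seq T) : seq (T * T) := zip (x :: p) p.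

Lemma steps_cat (T : Type) (x : T) p q :
  steps x (p ++ q) = steps x p ++ steps (last x p) q.
Proof. by elim: p x => [|y p IH] x //=; rewrite /steps /= -IH. Qed.

Lemma steps_cons (T : Type) (x y : T) p : steps x (y :: p) = (x, y) :: steps y p.
Proof. by []. Qed.

Lemma mem_steps (T : eqType) (x v w : T) p : (v, w) \in steps x p ->
  exists p1 p2, p = p1 ++ w :: p2 /\ last x p1 = v.
Proof.
elim: p x => [|y p IH] x //; rewrite steps_cons inE => /orP[/eqP[-> ->]|].
  by exists [::], p.
by move=> /IH[p1 [p2 [-> <-]]]; exists (y :: p1), p2.
Qed.

Lemma steps_mem (T : eqType) (x v w : T) p : (v, w) \in steps x p ->
  v \in x :: p /\ w \in x :: p.
Proof.
move=> /mem_steps[p1 [p2 [-> <-]]]; rewrite -cat_cons !mem_cat mem_last.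
by rewrite mem_head orbT.
Qed.

Lemma rotate_walk (T : eqType) (x y : T) p : last x p = x -> y \in x :: p ->
  exists p', [/\ last y p' = y, perm_eq (steps y p') (steps x p)
    & x :: p =i y :: p'].
Proof.
move=> lp; rewrite inE => /orP[/eqP->|/splitPr yp]; first by exists p.
case: yp lp => p1 p2; rewrite last_cat /= => lp.
exists (p2 ++ rcons p1 y); split; first by rewrite last_cat last_rcons.
  rewrite steps_cat lp -cat_rcons steps_cat last_rcons.
  by rewrite perm_catC.
have xp : x \in y :: p2 by rewrite -lp mem_last.
move=> z; rewrite !(inE, mem_cat, mem_rcons).
case: eqVneq => [->|_] /=; last by case: (z == y); case: (z \in p1); case: (z \in p2).
by move: xp; rewrite inE => /orP[->//|->]; rewrite !orbT.
Qed.

Lemma rotate_walk_step (T : eqType) (x v w : T) p : last x p = x ->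
  (v, w) \in steps x p ->
  exists p', [/\ last w p' = v, perm_eq (steps v (w :: p')) (steps x p)
    & x :: p =i v :: w :: p'].
Proof.
move=> lp /mem_steps[p1 [p2 [pE vE]]].
have lw : last w p2 = x by rewrite -[RHS]lp pE last_cat.
exists (p2 ++ p1); split; first by rewrite last_cat lw.
  rewrite pE -cat_cons steps_cat /= lw [in X in perm_eq _ X]steps_cat vE.
  by rewrite perm_sym perm_catC.
have xp : x \in w :: p2 by rewrite -lw mem_last.
have vp : v \in x :: p1 by rewrite -vE mem_last.
move=> z; rewrite pE !(inE, mem_cat).
case: (eqVneq z x) => [->|zx] /=.
  by move: xp; rewrite inE => /orP[->|->]; rewrite ?orbT.
case: (eqVneq z v) => [zv|_] /=; last by case: (z == w); case: (z \in p1); case: (z \in p2).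
by move: vp; rewrite -zv inE (negbTE zx) /= => ->.
Qed.

Section Multigraphs.
Context {n : nat}.
Implicit Types (e : edge n) (u v w x : 'I_n) (m : edge n -> nat)
  (st : seq ('I_n * 'I_n)).

(** A step from a vertex to itself counts for no edge ([degenerate_step]), so walks may stall;
    [nondeg] forbids this where degrees are counted exactly. *)
Definition mult st e : nat := count (fun z => val e == [set z.1; z.2]%SET) st.

Definition adj m : rel 'I_n :=
  fun v w => [exists e : edge n, (0 < m e)%N && (val e == [set v; w]%SET)].

Definition deg m u : nat := (\sum_(e : edge n | u \in val e) m e)%N.

Definition good m := multigraph_connected m /\ multigraph_eulerian m.

Definition nondeg st := all (fun z : 'I_n * 'I_n => z.1 != z.2) st.

Lemma mult_cat st1 st2 e : mult (st1 ++ st2) e = (mult st1 e + mult st2 e)%N.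
Proof. by rewrite /mult count_cat. Qed.

Lemma mult_perm st1 st2 e : perm_eq st1 st2 -> mult st1 e = mult st2 e.
Proof. by move=> /seq.permP h; exact: h. Qed.

Lemma mult_cons u v st e :
  mult ((u, v) :: st) e = ((val e == [set u; v]%SET) + mult st e)%N.
Proof. by []. Qed.

Lemma deg_step u v w : v != w ->
  deg (fun e => val e == [set v; w]%SET) u = ((u == v) + (u == w))%N.
Proof.
move=> vw; have [f fE] := edge_of vw.
rewrite /deg big_mkcond (bigD1 f)//= big1 => [|e ne].
  rewrite addn0 fE eqxx inE !inE /=.
  by case: (eqVneq u v) => [->|]; case: (eqVneq u w) => // ; rewrite ?(negbTE vw).
case: ifP => //; rewrite -fE; case: eqP => // /val_inj ef.
by rewrite ef eqxx in ne.
Qed.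

Lemma degenerate_step v e : (val e == [set v; v]%SET) = false.
Proof.
by apply/eqP => ee; have := valP e; rewrite ee finset.setUid cards1.
Qed.

Lemma degD m1 m2 u : deg (fun e => m1 e + m2 e)%N u = (deg m1 u + deg m2 u)%N.
Proof. by rewrite /deg big_split. Qed.

Lemma eq_deg m1 m2 u : m1 =1 m2 -> deg m1 u = deg m2 u.
Proof. by move=> h; apply: eq_bigr => e _; rewrite h. Qed.

Lemma deg_mult_cons v w st u : deg (mult ((v, w) :: st)) u =
  ((if v == w then 0 else (u == v) + (u == w)) + deg (mult st) u)%N.
Proof.
rewrite degD; congr addn; case: eqVneq => [->|vw]; last exact: deg_step.
by rewrite /deg big1// => e _; rewrite degenerate_step.
Qed.

Lemma odd_deg_walk x p u :
  odd (deg (mult (steps x p)) u) = (u == x) (+) (u == last x p).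
Proof.
elim: p x => [|y p IH] x; first by rewrite /deg big1// addbb.
rewrite steps_cons deg_mult_cons oddD IH /=; case: eqVneq => [->|xy] //.
by rewrite oddD !oddb -addbA; congr addb; rewrite addbA addbb.
Qed.

Lemma deg_walk x p u : nondeg (steps x p) ->
  (deg (mult (steps x p)) u + (u == last x p))%N = ((u == x) + (count_mem u p).*2)%N.
Proof.
elim: p x => [|y p IH] x; first by rewrite /deg big1// addn0.
rewrite steps_cons deg_mult_cons /= => /andP[/= /negbTE xy /IH h].
by rewrite xy -!addnA h (eq_sym y u) doubleD -muln2; lia.
Qed.

Lemma connect_walk m x p u : (forall e, (mult (steps x p) e <= m e)%N) ->
  u \in x :: p -> connect (adj m) x u.
Proof.
elim: p x => [|y p IH] x hm; first by rewrite inE => /eqP->.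
rewrite inE => /orP[/eqP->//|up].
have {}IH : connect (adj m) y u.
  apply: IH => // e; apply: leq_trans (hm e).
  by rewrite steps_cons mult_cons leq_addl.
case: (eqVneq x y) => [->//|xy]; apply: connect_trans IH.
apply: connect1; have [e eE] := edge_of xy.
apply/fintype.existsP; exists e; rewrite eE eqxx andbT.
by apply: leq_trans (hm e); rewrite steps_cons mult_cons eE eqxx.
Qed.

Lemma adj_sym m : connect_sym (adj m).
Proof.
apply: fingraph.sym_connect_sym => v w.
by apply: eq_existsb => e; rewrite finset.setUC.
Qed.

Lemma good_walk x p : last x p = x -> (forall u, u \in x :: p) ->
  good (mult (steps x p)).
Proof.
move=> lp hp; split=> [u v|u].
  apply: (@connect_trans _ _ x); last exact: connect_walk.
  by rewrite adj_sym; apply: connect_walk.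
by have := odd_deg_walk x p u; rewrite lp addbb => /negbT.
Qed.

Lemma pop_edge m x : (0 < deg m x)%N -> exists t m', x != t /\
  forall e, m e = ((val e == [set x; t]%SET) + m' e)%N.
Proof.
rewrite lt0n sum_nat_eq0 negb_forall => /fintype.existsP[e].
rewrite negb_imply -lt0n => /andP[xe me].
have [t [xt eE]] : exists t, x != t /\ val e = [set x; t]%SET.
  have [u [v [uv eE]]] := edge_ends e; move: xe.
  rewrite eE => /finset.set2P[->|->]; first by exists v.
  by exists u; rewrite eq_sym finset.setUC.
exists t, (fun f => m f - (val f == [set x; t]%SET))%N; split=> // f.
rewrite subnKC//; case: eqP => // fE; suff -> : f = e by [].
by apply: val_inj; rewrite fE eE.
Qed.

Lemma deg_pop m m' x t u : x != t ->
  (forall e, m e = ((val e == [set x; t]%SET) + m' e)%N) ->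
  deg m u = ((u == x) + (u == t) + deg m' u)%N.
Proof. by move=> xt h; rewrite (eq_deg _ h) degD deg_step. Qed.

Lemma total_pop m m' x t : x != t ->
  (forall e, m e = ((val e == [set x; t]%SET) + m' e)%N) ->
  (\sum_e m' e < \sum_e m e)%N.
Proof.
move=> xt h; rewrite (eq_bigr _ (fun e _ => h e)) big_split /= -[X in (X < _)%N]add0n ltn_add2r.
by have [e eE] := edge_of xt; rewrite (bigD1 e)//= eE eqxx.
Qed.

(** Walk greedily: the current start has odd, hence positive, degree, and deleting the edge just
    used moves the odd degree to its other end. *)
Lemma trail m x y : x != y ->
  (forall u, odd (deg m u) = (u == x) (+) (u == y)) ->
  exists p, [/\ last x p = y, nondeg (steps x p)
    & forall e, (mult (steps x p) e <= m e)%N].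
Proof.
have [N] := ubnP (\sum_e m e)%N; elim: N m x => // N IH m x mN xy hm.
have : (0 < deg m x)%N by apply: odd_gt0; rewrite hm eqxx (negbTE xy).
move=> /pop_edge[t [m' [xt mE]]].
case: (eqVneq t y) => [ty|ty].
  exists [:: y]; split=> [//||e]; first by rewrite /nondeg /= xy.
  by rewrite mE ty mult_cons leq_add2l.
have [||p [lp ndp hp]] := IH m' t _ ty.
- by apply: leq_trans (total_pop xt mE) _; rewrite -ltnS.
- move=> u; have := hm u; rewrite (deg_pop _ xt mE) !oddD !oddb.
  by case: (u == x); case: (u == t); case: (u == y); case: (odd _).
exists (t :: p); split=> [//||e]; first by rewrite /nondeg /= xt.
by rewrite mE steps_cons mult_cons leq_add2l.
Qed.

Lemma absorb_circuits x p m : last x p = x -> nondeg (steps x p) ->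
  multigraph_eulerian m ->
  multigraph_connected (fun e => mult (steps x p) e + m e)%N ->
  exists y q, [/\ last y q = y, nondeg (steps y q), (forall u, u \in y :: q)
    & forall e, mult (steps y q) e = (mult (steps x p) e + m e)%N].
Proof.
have [N] := ubnP (\sum_e m e)%N; elim: N x p m => // N IH x p m mN lp ndp em cm.
have [[w wp dw]|dm] := pselect (exists2 w, w \in x :: p & (0 < deg m w)%N).
  have [t [m1 [wt mE]]] := pop_edge dw.
  have tw : t != w by rewrite eq_sym.
  have [u|q [lq ndq hq]] := @trail m1 t w tw.
    have := em u; rewrite -/(deg m u) (deg_pop _ wt mE) !oddD !oddb.
    by case: (u == w); case: (u == t); case: (odd _).
  have [p' [lp' pp' _]] := rotate_walk lp wp.
  pose m2 e := (m1 e - mult (steps t q) e)%N.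
  have m1E e : m1 e = (mult (steps t q) e + m2 e)%N by rewrite subnKC.
  have stE : steps w ((t :: q) ++ p') = (w, t) :: steps t q ++ steps w p'.
    by rewrite cat_cons steps_cons steps_cat lq.
  have multE e : (mult (steps w ((t :: q) ++ p')) e + m2 e)%N =
      (mult (steps x p) e + m e)%N.
    rewrite stE mult_cons mult_cat (mult_perm _ pp') mE m1E.
    by rewrite -!addnA [in RHS]addnCA; congr (_ + _)%N; rewrite addnCA.
  have [|||||y [q' [h1 h2 h3 h4]]] := IH w ((t :: q) ++ p') m2.
  - apply: (@leq_ltn_trans (\sum_e m1 e)%N); last exact: leq_trans (total_pop wt mE) _.
    by apply: leq_sum => e _; exact: leq_subr.
  - by rewrite last_cat /= lq.
  - rewrite stE /nondeg /= wt all_cat -/(nondeg _) ndq /=.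
    by rewrite (perm_all _ pp').
  - move=> u; rewrite -/(deg m2 u).
    have := em u; rewrite -/(deg m u) (deg_pop _ wt mE) (eq_deg _ m1E) degD.
    have := odd_deg_walk t q u; rewrite lq !oddD !oddb => ->.
    by case: (u == w); case: (u == t); case: (odd _).
  - by rewrite (_ : (fun e => _) = fun e => (mult (steps x p) e + m e)%N) //; apply/funext.
  by exists y, q'; split=> // e; rewrite h4.
have dm0 w : w \in x :: p -> deg m w = 0%N.
  by move=> wp; apply/eqP; rewrite -leqn0 leqNgt; apply/negP => h; apply: dm; exists w.
have clo : fingraph.closed (adj (fun e => mult (steps x p) e + m e)%N) [in x :: p].
  move=> v w /fintype.existsP[e /andP[he /eqP eE]].
  have [me|m0] := ltnP 0 (m e).
    have out u : u \in val e -> (u \in x :: p) = false.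
      move=> ue; apply/negP => /dm0/eqP; rewrite sum_nat_eq0.
      by move=> /fintype.forallP/(_ e); rewrite ue /= => /eqP m0; rewrite m0 in me.
    by rewrite !out// eE ?set21 ?set22.
  have {}m0 : m e = 0%N by apply/eqP; rewrite -leqn0.
  move: he; rewrite m0 addn0 -has_count => /hasP[[z1 z2] zs zE0].
  have {zE0} zE : val e = [set z1; z2]%SET by apply/eqP.
  have [z1p z2p] := steps_mem zs.
  have inp u : u \in val e -> u \in x :: p.
    by rewrite zE => /finset.set2P[->|->].
  by rewrite !inp// eE ?set21 ?set22.
have allp u : u \in x :: p.
  have := closed_connect clo (cm x u); rewrite mem_head => /esym; exact.
exists x, p; split=> // e; have [u [v [_ eE]]] := edge_ends e.
have /eqP := dm0 u (allp u); rewrite sum_nat_eq0 => /fintype.forallP/(_ e).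
by rewrite eE set21 /= => /eqP ->; rewrite addn0.
Qed.

Lemma euler_walk m (v : 'I_n) : good m ->
  exists y q, [/\ last y q = y, nondeg (steps y q), (forall u, u \in y :: q)
    & forall e, mult (steps y q) e = m e].
Proof.
by case=> cm em; apply: (@absorb_circuits v [::]).
Qed.

End Multigraphs.

(** * Hamilton cycles and local surgery *)

Section Cycles.
Context {T : eqType}.
Implicit Types (x y u : T) (p c : seq T).

Lemma steps_next x p : uniq (x :: p) ->
  steps x (rcons p x) = [seq (u, next (x :: p) u) | u <- x :: p].
Proof.
(* The closing vertex is generalised: the induction changes the head but not the vertex returned
   to. *)
suff H y0 : uniq (x :: p) ->
  steps x (rcons p y0) = [seq (u, next_at u y0 x p) | u <- x :: p] by exact: H.
elim: p x => [|y p IH] x; first by rewrite /= eqxx.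
move=> /[dup] /andP[xp up] _; rewrite rcons_cons steps_cons IH//= eqxx.
congr cons; rewrite -[LHS]/(map _ (y :: p)) -[RHS]/(map _ (y :: p)).
by apply/eq_in_map => u up'; case: eqP => // ux; rewrite -ux up' in xp.
Qed.

Lemma next_neq c u : uniq c -> (1 < size c)%N -> u \in c -> next c u != u.
Proof.
move=> uc sc uinc; have [i c' cE] := rot_to uinc.
rewrite -(next_rot i uc) cE.
have : uniq (u :: c') by rewrite -cE rot_uniq.
have : (1 < size (u :: c'))%N by rewrite -cE size_rot.
case: c' {cE} => // y c' _ /andP[]; rewrite inE negb_or /= eqxx eq_sym.
by case/andP.
Qed.

(** With three vertices or more, a tour never runs back along an edge; hence its edges all have
    multiplicity one. *)
Lemma next_next_neq c u : uniq c -> (2 < size c)%N -> u \in c ->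
  next c (next c u) != u.
Proof.
move=> uc sc uinc; have [i c' cE] := rot_to uinc.
rewrite -!(next_rot i uc) cE.
have : uniq (u :: c') by rewrite -cE rot_uniq.
have : (2 < size (u :: c'))%N by rewrite -cE size_rot.
case: c' {cE} => [|y [|z c']] // _ /and3P[].
rewrite !inE !negb_or /= eqxx => /and3P[uy uz _] _ _.
by rewrite eq_sym [y == u]eq_sym (negbTE uy) eqxx.
Qed.

End Cycles.

Lemma set2_eq (T : finType) (u v x y : T) : [set u; v]%SET = [set x; y]%SET ->
  (u = x /\ v = y) \/ (u = y /\ v = x).
Proof.
move=> h.
have /finset.set2P : u \in [set x; y]%SET by rewrite -h set21.
have /finset.set2P : v \in [set x; y]%SET by rewrite -h set22.
have /finset.set2P : x \in [set u; v]%SET by rewrite h set21.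
have /finset.set2P : y \in [set u; v]%SET by rewrite h set22.
by do 4![case=> ?]; subst; auto.
Qed.

Section Tours.
Context {n : nat}.
Hypothesis hn : (2 < n)%N.
Implicit Types (e : edge n) (u v w : 'I_n) (c : seq 'I_n).

Lemma hamilton_size c : hamilton_cycle c -> size c = n.
Proof.
case=> uc hc; rewrite -[RHS]card_ord -(card_uniqP uc).
by apply: eq_card => u; rewrite hc.
Qed.

Lemma cycle_edges_mult x p e : hamilton_cycle (x :: p) ->
  (e \in cycle_edges (x :: p)) = mult (steps x (rcons p x)) e :> nat.
Proof.
move=> hc; have sc := hamilton_size hc; case: (hc) => uc hu.
rewrite steps_next// /mult count_map inE; set c := x :: p in sc uc hu *.
case: fintype.existsP => [[u /andP[ucc /eqP eE]]|ne]; last first.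
  apply/esym/eqP; rewrite -leqn0 leqNgt -has_count; apply/hasP => -[u ucc eE].
  by apply: ne; exists u; rewrite ucc.
rewrite (eq_in_count (a2 := pred1 u)) ?count_uniq_mem ?ucc// => v vc /=.
rewrite eE; apply/eqP/eqP => [/set2_eq[[]//|[uv vu]]|->//].
by have := @next_next_neq _ c u uc; rewrite sc ucc vu [next c v]/= -uv eqxx => /(_ hn isT).
Qed.

Lemma hamilton_nondeg (x : 'I_n) p : hamilton_cycle (x :: p) -> nondeg (steps x (rcons p x)).
Proof.
move=> hc; have sc := hamilton_size hc; case: hc => uc _.
rewrite steps_next// /nondeg all_map; apply/allP => u uc' /=.
rewrite eq_sym; apply: (@next_neq _ (x :: p)) => //.
by rewrite sc; exact: ltnW.
Qed.

Lemma hamilton_good c : hamilton_cycle c -> good (fun e => e \in cycle_edges c).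
Proof.
move=> hc; have := hamilton_size hc; case: c hc => [|x p] hc sc.
  by have := hn; rewrite -{1}sc.
rewrite (_ : (fun e => _) = mult (steps x (rcons p x))); last first.
  by apply/funext => e; rewrite cycle_edges_mult.
apply: good_walk; rewrite ?last_rcons// => u.
by rewrite inE mem_rcons (hc.2 u) orbT.
Qed.

Lemma deg_hamilton c u : hamilton_cycle c -> deg (fun e => e \in cycle_edges c) u = 2%N.
Proof.
move=> hc; have := hamilton_size hc; case: c hc => [|x p] hc sc.
  by have := hn; rewrite -{1}sc.
rewrite (eq_deg _ (fun e => cycle_edges_mult e hc)).
have := deg_walk u (hamilton_nondeg hc); rewrite last_rcons addnC => /addnI ->.
rewrite -cats1 count_cat addnC -count_cat /= -/(count_mem u (x :: p)).
by rewrite count_uniq_mem ?hc.2 // hc.1.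
Qed.

End Tours.

Section Surgery.
Context {n : nat}.
Implicit Types (e : edge n) (u v w : 'I_n) (m : edge n -> nat).

Lemma good_edge_walk m e : good m -> (0 < m e)%N ->
  exists v w p, [/\ val e = [set v; w]%SET, v != w, last w p = v,
    (forall u, u \in v :: w :: p) & mult (steps v (w :: p)) =1 m].
Proof.
move=> gm; have [v0 _] := edge_ends e; have [y [q [lq ndq hq mq]]] := euler_walk v0 gm.
rewrite -mq -has_count => /hasP[[v w] vw eE0].
have {eE0} eE : val e = [set v; w]%SET by apply/eqP.
have [p [lp pp hp]] := rotate_walk_step lq vw.
exists v, w, p; split=> //; first exact: (allP ndq _ vw).
  by move=> u; rewrite -hp.
by move=> f; rewrite (mult_perm _ pp) mq.
Qed.

(** Inserting [u] between the ends of [e] in an Euler walk keeps it closed and spanning. The balance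
    is stated without subtraction, multiplicities being natural numbers. *)
Lemma good_detour m e u v w (gm : good m) : (0 < m e)%N -> val e = [set v; w]%SET ->
  exists st, good (mult st) /\ forall f, (mult st f + (val f == [set v; w]%SET) =
    m f + (val f == [set v; u]%SET) + (val f == [set u; w]%SET))%N.
Proof.
move=> me; have [x [y [p [-> xy lp hp mE]]]] := good_edge_walk gm me.
move=> eE; exists (steps x (u :: y :: p)); split.
  by apply: good_walk => //= z; have := hp z; rewrite !inE => /or3P[->|->|->]; rewrite ?orbT.
move=> f; rewrite -mE !steps_cons !mult_cons.
have [[-> ->]|[-> ->]] := set2_eq eE.
  by lia.
rewrite [[set v; u]%SET]finset.setUC [[set u; w]%SET]finset.setUC [[set v; w]%SET]finset.setUC.
by lia.
Qed.

Lemma good_shortcut m u : good m -> (2 < deg m u)%N ->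
  exists v w st, [/\ u != v, u != w, good (mult st) & forall f,
    (mult st f + (val f == [set v; u]%SET) + (val f == [set u; w]%SET) =
     m f + (val f == [set v; w]%SET))%N].
Proof.
move=> gm du; have [y [q [lq ndq hq mq]]] := euler_walk u gm.
have [p [lp pp hp]] := rotate_walk lq (hq u).
have ndp : nondeg (steps u p) by rewrite /nondeg (perm_all _ pp).
have cp : (2 <= count_mem u p)%N.
  have := deg_walk u ndp; rewrite lp addnC => /addnI.
  rewrite (eq_deg u (fun e => mult_perm e pp)) (eq_deg u mq) => dE.
  by rewrite dE in du; lia.
case/lastP: p lp pp hp ndp cp => // p z; rewrite last_rcons => ->.
rewrite -cats1 count_cat /= eqxx addn0 addn1 ltnS => pp hp ndp cp.
have /splitPr up : u \in p by rewrite -has_pred1 has_count.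
case: up pp hp ndp {cp} => p1 p2; rewrite -catA cat_cons.
have [w [r rE]] : exists w r, p2 ++ [:: u] = w :: r by case: p2 => [|w r]; eexists; eexists.
have lr : last w r = u by have := congr1 (last u) rE; rewrite last_cat.
rewrite rE => pp hp ndp.
move: ndp; rewrite /nondeg steps_cat !steps_cons all_cat /= => /and4P[_ vu uw _].
exists (last u p1), w, (steps u (p1 ++ w :: r)); split=> [|||f]; first by rewrite eq_sym.
- by [].
- apply: good_walk => [|t]; first by rewrite last_cat.
  by have := hq t; rewrite hp !(inE, mem_cat); case: (t == u).
rewrite -mq -(mult_perm f pp) !steps_cat !steps_cons !mult_cat !mult_cons.
by rewrite -!addnA; congr addn; rewrite [LHS]addnC -!addnA addnCA; congr addn; rewrite addnCA.
Qed.

End Surgery.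

(** * Costs, shortcuts and exchanges *)

Section Costs.
Context {R : realType} {n : nat}.
Implicit Types (e : edge n) (u v w : 'I_n) (a b : edge_space R n)
  (m : edge n -> nat) (c : seq 'I_n) (st : seq ('I_n * 'I_n)).

Definition mvec m : edge_space R n := edge_vec (fun e => (m e)%:R).

Definition tour c : edge_space R n := char_vec R (cycle_edges c).

Definition cost a st := \sum_(z <- st) ev a z.1 z.2.

Lemma tourE c : tour c = mvec (fun e => e \in cycle_edges c).
Proof. by []. Qed.

Lemma coord_mvec m e : coord (mvec m) e = (m e)%:R.
Proof. by rewrite coord_vec. Qed.

Lemma dot_mvec a m : dot a (mvec m) = \sum_(e : edge n) coord a e * (m e)%:R.
Proof. by rewrite dot_coord; apply: eq_bigr => e _; rewrite coord_mvec. Qed.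

Lemma dot_mvecD a m1 m2 :
  dot a (mvec (fun e => m1 e + m2 e)%N) = dot a (mvec m1) + dot a (mvec m2).
Proof.
by rewrite !dot_mvec -big_split; apply: eq_bigr => e _; rewrite natrD mulrDr.
Qed.

Lemma dot_mvec_edge a u v : dot a (mvec (fun e => val e == [set u; v]%SET)) = ev a u v.
Proof.
rewrite dot_mvec /ev [RHS]big_mkcond; apply: eq_bigr => e _.
by case: eqP; rewrite ?mulr1 ?mulr0.
Qed.

Lemma dot_mult a st : dot a (mvec (mult st)) = cost a st.
Proof.
rewrite dot_mvec /cost /ev; under [RHS]eq_bigr do rewrite big_mkcond.
rewrite exchange_big; apply: eq_bigr => e _; rewrite /mult -sum1_count.
rewrite natr_sum mulr_sumr [LHS]big_mkcond; apply: eq_bigr => z _.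
by case: ifP; rewrite ?mulr1.
Qed.

Lemma eq_mvec m1 m2 : m1 =1 m2 -> mvec m1 = mvec m2.
Proof. by move=> h; congr edge_vec; apply/funext => e; rewrite h. Qed.

Lemma dot_delta_mvec u m : dot (delta R u) (mvec m) = (deg m u)%:R / 2.
Proof.
rewrite dot_mvec /deg natr_sum mulr_suml [RHS]big_mkcond; apply: eq_bigr => e _.
by rewrite coord_vec; case: ifP; rewrite ?mul0r// mulrC.
Qed.

Lemma dot_tour_walk a x p : (2 < n)%N -> hamilton_cycle (x :: p) ->
  dot a (tour (x :: p)) = cost a (steps x (rcons p x)).
Proof.
move=> hn hc; rewrite -dot_mult tourE; congr dot; apply: eq_mvec => e.
exact: cycle_edges_mult.
Qed.

Lemma dot_detour m e u v w : good m -> (0 < m e)%N -> val e = [set v; w]%SET ->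
  exists m', good m' /\ forall a,
    dot a (mvec m') = dot a (mvec m) + ev a v u + ev a u w - ev a v w.
Proof.
move=> gm me eE; have [st [gst stE]] := good_detour u gm me eE.
exists (mult st); split=> // a; rewrite -!dot_mvec_edge -!dot_mvecD.
by rewrite -(eq_mvec stE) dot_mvecD addrK.
Qed.

Lemma dot_shortcut m u : good m -> (2 < deg m u)%N ->
  exists v w m', [/\ u != v, u != w, good m' & forall a,
    dot a (mvec m') = dot a (mvec m) + ev a v w - ev a v u - ev a u w].
Proof.
move=> gm du; have [v [w [st [uv uw gst stE]]]] := good_shortcut gm du.
exists v, w, (mult st); split=> // a; rewrite -!dot_mvec_edge -!dot_mvecD.
by rewrite -(eq_mvec stE) !dot_mvecD [X in X - _]addrAC !addrK.
Qed.

Definition metric a := forall u v w, ev a u v <= ev a u w + ev a w v.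

Lemma metric_ge0 a u v : metric a -> 0 <= ev a u v.
Proof. by move=> /(_ u u v); rewrite evxx (ev_sym _ v); lra. Qed.

Lemma cost_cons a u v st : cost a ((u, v) :: st) = ev a u v + cost a st.
Proof. by rewrite /cost big_cons. Qed.

Lemma cost_subseq a : metric a -> forall p q x y, subseq q p ->
  cost a (steps x (rcons q y)) <= cost a (steps x (rcons p y)).
Proof.
move=> ma; elim=> [|z p IH] q x y; first by rewrite subseq0 => /eqP->.
have skip r : cost a (steps x (rcons r y)) <= ev a x z + cost a (steps z (rcons r y)).
  case: r => [|t r]; rewrite ?rcons_cons /= !steps_cons !cost_cons addrA lerD2r;
  exact: ma.
rewrite rcons_cons steps_cons cost_cons.
case: q => [_|t q /=]; first by apply: le_trans (skip _) _; rewrite lerD2l IH ?sub0seq.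
case: eqVneq => [->|_] h; first by rewrite steps_cons cost_cons lerD2l IH.
by apply: (le_trans (skip (t :: q))); rewrite lerD2l IH.
Qed.

Lemma tour_through a m e : (2 < n)%N -> metric a -> good m -> (0 < m e)%N ->
  exists c, [/\ hamilton_cycle c, e \in cycle_edges c
    & dot a (tour c) <= dot a (mvec m)].
Proof.
move=> hn ma gm me; have [v [w [p [eE vw lp hp mE]]]] := good_edge_walk gm me.
case/lastP: p lp hp mE => [/=wv|p z]; first by rewrite wv eqxx in vw.
rewrite last_rcons => -> hp mE.
(* The walk begins with [e]; removing the ends of [e] from the rest keeps this first step in the
   shortcut tour. *)
pose q := undup [seq z <- p | (z != v) && (z != w)].
have hc : hamilton_cycle (v :: w :: q).
  split=> [|u].
    by rewrite /= undup_uniq !inE !mem_undup !mem_filter !eqxx /= andbF (negbTE vw).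
  have := hp u; rewrite !inE mem_rcons inE mem_undup mem_filter.
  by case: (u == v); case: (u == w).
exists (v :: w :: q); split=> //.
  rewrite inE; apply/fintype.existsP; exists v; rewrite inE eqxx /=.
  by rewrite eE eqxx.
rewrite dot_tour_walk// -(eq_mvec mE) dot_mult.
rewrite rcons_cons !steps_cons !cost_cons lerD2l; apply: cost_subseq => //.
by apply: subseq_trans (undup_subseq _) (filter_subseq _ _).
Qed.

Lemma mult_rev x y p e :
  mult (steps x (rcons p y)) e = mult (steps y (rcons (rev p) x)) e.
Proof.
elim: p x => [|z p IH] x; first by rewrite /steps /= /mult /= finset.setUC.
rewrite rcons_cons steps_cons mult_cons IH rev_cons -(cats1 (rcons _ z)) steps_cat last_rcons.
by rewrite mult_cat addnC [X in _ = (_ + X)%N]mult_cons addn0 finset.setUC.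
Qed.

Lemma cost_cat a st1 st2 : cost a (st1 ++ st2) = cost a st1 + cost a st2.
Proof. by rewrite /cost big_cat. Qed.

Lemma cost_rev a x y p :
  cost a (steps x (rcons p y)) = cost a (steps y (rcons (rev p) x)).
Proof.
by rewrite -!dot_mult; congr dot; apply: eq_mvec => e; exact: mult_rev.
Qed.

Lemma mult_eq0 x p e z : z \in val e -> z \notin x :: p -> mult (steps x p) e = 0%N.
Proof.
move=> ze zp; apply/eqP; rewrite -leqn0 leqNgt -has_count; apply/hasP => -[[v w] vw eE].
have {}eE : val e = [set v; w]%SET by apply/eqP.
have [vp wp] := steps_mem vw; move: ze; rewrite eE.
by move=> /finset.set2P[zE|zE]; rewrite zE ?vp ?wp in zp.
Qed.

End Costs.

Section Exchange.
Context {n : nat}.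
Hypothesis hn : (5 <= n)%N.
Implicit Types (e : edge n) (i j k l u v w : 'I_n) (c : seq 'I_n).

Lemma fresh (s : seq 'I_n) : (size s <= 4)%N -> exists x, x \notin s.
Proof.
move=> ss; apply/fintype.existsP; rewrite -[X in is_true X]negbK negb_exists.
apply/negP => /fintype.forallP h; move: hn; rewrite ltnNge => /negP; apply.
rewrite -[n in (n <= _)%N]card_ord; apply: leq_trans ss.
apply: leq_trans (card_size s); apply: subset_leq_card; apply/fintype.subsetP => x _.
by have := h x; rewrite negbK.
Qed.

Lemma hamilton_split (P : pred 'I_n) i j k l : uniq [:: i; j; k; l] ->
  let rest := [seq z <- enum 'I_n | z \notin [:: i; j; k; l]] in
  hamilton_cycle (i :: j :: seq.filter P rest ++ k :: l :: seq.filter (predC P) rest).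
Proof.
move=> uq rest.
have pE : perm_eq (i :: j :: seq.filter P rest ++ k :: l :: seq.filter (predC P) rest)
   ([:: i; j; k; l] ++ rest).
  rewrite !perm_cons -[k :: l :: _]/([:: k; l] ++ _) perm_catCA !perm_cons.
  by rewrite perm_filterC.
split=> [|u]; last first.
  by rewrite (perm_mem pE) mem_cat mem_filter mem_enum andbT orbN.
rewrite (perm_uniq pE) cat_uniq uq filter_uniq ?enum_uniq// andbT /=.
by apply/hasPn => z; rewrite mem_filter => /andP[].
Qed.

(** The vertices other than the four may be distributed freely over the two segments; this is done
    so that [e] joins no neighbours in either. *)
Lemma avoiding_split e i j k l : uniq [:: i; j; k; l] ->
  val e != [set i; j]%SET -> val e != [set k; l]%SET ->
  val e != [set i; k]%SET -> val e != [set j; l]%SET -> val e != [set i; l]%SET ->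
  exists A B, [/\ hamilton_cycle (i :: j :: A ++ k :: l :: B),
    mult (steps j (rcons A k)) e = 0%N & mult (steps l (rcons B i)) e = 0%N].
Proof.
move=> uq eij ekl eik ejl eil.
pose rest := [seq z <- enum 'I_n | z \notin [:: i; j; k; l]].
(* Here all other vertices go between [j] and [k]; a fifth vertex exists, so these two do not become
   neighbours. *)
have [jk|ejk] := eqVneq (val e) [set j; k]%SET.
  exists (seq.filter predT rest), (seq.filter (predC predT) rest).
  split; first exact: hamilton_split.
    have [x xq] := fresh (isT : (size [:: i; j; k; l] <= 4)%N).
    rewrite filter_predT.
    have jr : j \notin rest by rewrite mem_filter !inE eqxx orbT.
    have : x \in rest by rewrite mem_filter mem_enum xq.
    have kr : k \notin rest by rewrite mem_filter !inE eqxx !orbT.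
    case: (rest) jr kr => // y A jr kr _; rewrite rcons_cons steps_cons mult_cons jk.
    move: uq; rewrite /= !inE !negb_or => /and4P[/and3P[ij ik il] /andP[jk' jl] kl _].
    case: eqP => [/set2_eq[[_ ky]|[jy _]]|_].
    - by rewrite ky mem_head in kr.
    - by rewrite jy mem_head in jr.
    apply: (@mult_eq0 _ _ _ _ j); first by rewrite jk set21.
    by move: jr; rewrite !inE mem_rcons inE (negbTE jk').
  apply: (@mult_eq0 _ _ _ _ j); first by rewrite jk set21.
  move: uq; rewrite /= !inE !mem_rcons !inE !negb_or mem_filter /=.
  by rewrite [j == i]eq_sym => /and4P[/andP[-> _] /andP[_ ->]].
have [s [t [st eE]]] := edge_ends e.
(* All six pairs among the four vertices are now excluded, so [e] has an end [s] outside them. *)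
wlog sq : s t st eE / s \notin [:: i; j; k; l].
  move=> W; have [h|h] := boolP (s \notin [:: i; j; k; l]); first exact: W st eE h.
  apply: (W t s); rewrite 1?eq_sym 1?finset.setUC//; apply/negP => h'.
  move: h; rewrite negbK => h.
  have bad x y : val e != [set x; y]%SET -> ~ ((s = x /\ t = y) \/ (s = y /\ t = x)).
    by rewrite eE => /eqP xy [[sx ty]|[sy tx]]; apply: xy; subst; rewrite // finset.setUC.
  move: h h'; rewrite !inE => /or4P[]/eqP sE /or4P[]/eqP tE; move/eqP: st;
  have := bad _ _ eij; have := bad _ _ ekl; have := bad _ _ eik; have := bad _ _ ejl;
  have := bad _ _ eil; have := bad _ _ ejk; subst; tauto.
(* [s] alone fills one segment: the one between [j] and [k] if [t] is [i] or [l], otherwise the one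
   between [l] and [i]. Thus [t] is not an end of the segment of [s], and the other segment misses
   [s]. *)
exists (seq.filter (fun z => (z == s) == (t \in [:: i; l])) rest),
  (seq.filter (predC (fun z => (z == s) == (t \in [:: i; l]))) rest).
split; first exact: hamilton_split.
  have [til|til] := boolP (t \in [:: i; l]).
    apply: (@mult_eq0 _ _ _ _ t); first by rewrite eE set22.
    rewrite inE mem_rcons inE mem_filter eqb_id [t == s]eq_sym (negbTE st) /= orbF.
    move: uq til; rewrite /= !inE !negb_or => /and4P[/and3P[ij ik il] /andP[jk jl] kl _].
    by move=> /orP[]/eqP ->; rewrite ?ij ?ik// ![l == _]eq_sym kl jl.
  apply: (@mult_eq0 _ _ _ _ s); first by rewrite eE set21.
  rewrite inE mem_rcons inE mem_filter eqxx /= orbF.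
  by move: sq; rewrite !inE !negb_or => /and4P[_ -> -> _].
have [til|til] := boolP (t \in [:: i; l]).
  apply: (@mult_eq0 _ _ _ _ s); first by rewrite eE set21.
  rewrite inE mem_rcons inE mem_filter /= eqxx /= orbF.
  by move: sq; rewrite !inE !negb_or => /and4P[-> _ _ ->].
apply: (@mult_eq0 _ _ _ _ t); first by rewrite eE set22.
rewrite inE mem_rcons inE mem_filter /= [t == s]eq_sym (negbTE st) /= orbF.
by move: til; rewrite !inE !negb_or => /andP[-> ->].
Qed.

(** A 2-exchange: reversing the segment from [j] to [k] replaces the edges [ij], [kl] by [ik], [jl].
    For a functional constant on the tours avoiding [e], this gives four-point equalities away from
    [e]. *)
Lemma exchange e i j k l : uniq [:: i; j; k; l] ->
  val e != [set i; j]%SET -> val e != [set k; l]%SET ->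
  val e != [set i; k]%SET -> val e != [set j; l]%SET ->
  exists c c', [/\ hamilton_cycle c, hamilton_cycle c', e \notin cycle_edges c,
    e \notin cycle_edges c' & forall (R : realType) (a : edge_space R n),
    dot a (tour c) + ev a i k + ev a j l = dot a (tour c') + ev a i j + ev a k l].
Proof.
have hn2 : (2 < n)%N by apply: leq_trans hn.
(* Reversing both edges interchanges the pairs [il] and [jk], and [e] cannot be both. *)
wlog eil : i j k l / val e != [set i; l]%SET.
  move=> W uq eij ekl eik ejl.
  have [eil|] := eqVneq (val e) [set i; l]%SET; last by move=> /W; apply.
  have [|||||| c [c' [hc hc' ec ec' cE]]] := W j i l k.
  - rewrite eil; apply: contraTN uq => /eqP/set2_eq.
    by move=> [[-> _]|[-> _]]; rewrite /= !inE eqxx ?orbT ?andbF.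
  - move: uq; rewrite /= !inE !negb_or [j == i]eq_sym [l == k]eq_sym.
    by move=> /and4P[/and3P[-> -> ->] /andP[-> ->] -> _].
  - by rewrite finset.setUC.
  - by rewrite finset.setUC.
  - by [].
  - by [].
  exists c, c'; split=> // R a.
  by have := cE R a; rewrite (ev_sym _ j i) (ev_sym _ l k); lra.
move=> uq eij ekl eik ejl.
have [A [B [hc mA mB]]] := avoiding_split uq eij ekl eik ejl eil.
have hc' : hamilton_cycle (i :: k :: rev A ++ j :: l :: B).
  have pE : perm_eq (i :: k :: rev A ++ j :: l :: B) (i :: j :: A ++ k :: l :: B).
    apply/seq.permP => P; rewrite /= !count_cat /= count_rev; congr addn.
    by rewrite [LHS]addnCA [RHS]addnCA; congr addn; exact: addnCA.
  by split=> [|u]; rewrite ?(perm_uniq pE) ?(perm_mem pE); case: hc.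
have cE : steps i (rcons (j :: A ++ k :: l :: B) i) =
    (i, j) :: steps j (rcons A k) ++ (k, l) :: steps l (rcons B i).
  by rewrite rcons_cons steps_cons rcons_cat !rcons_cons -cat_rcons steps_cat last_rcons.
have c'E : steps i (rcons (k :: rev A ++ j :: l :: B) i) =
    (i, k) :: steps k (rcons (rev A) j) ++ (j, l) :: steps l (rcons B i).
  by rewrite rcons_cons steps_cons rcons_cat !rcons_cons -cat_rcons steps_cat last_rcons.
exists (i :: j :: A ++ k :: l :: B), (i :: k :: rev A ++ j :: l :: B).
split=> //.
- rewrite -[_ \in _]lt0b -eqn0Ngt cycle_edges_mult// cE mult_cons mult_cat mult_cons.
  by rewrite mA mB (negbTE eij) (negbTE ekl).
- rewrite -[_ \in _]lt0b -eqn0Ngt cycle_edges_mult// c'E mult_cons mult_cat mult_cons.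
  by rewrite -mult_rev mA mB (negbTE eik) (negbTE ejl).
move=> R a; rewrite !dot_tour_walk// cE c'E !cost_cons.
rewrite !cost_cat !cost_cons -(cost_rev a j); lra.
Qed.

End Exchange.

(** * Inner products and the projection onto [Lspace] *)

Section Dot.
Context {R : realType} {d : nat}.
Implicit Types (x y z : 'rV[R]_d) (k : R).

Lemma dotC x y : dot x y = dot y x.
Proof. by apply: eq_bigr => i _; rewrite mulrC. Qed.

Lemma dotDr x y z : dot x (y + z) = dot x y + dot x z.
Proof. by rewrite /dot -big_split; apply: eq_bigr => i _; rewrite mxE mulrDr. Qed.

Lemma dotZr x k y : dot x (k *: y) = k * dot x y.
Proof. by rewrite /dot mulr_sumr; apply: eq_bigr => i _; rewrite mxE mulrCA. Qed.

Lemma dotDl x y z : dot (x + y) z = dot x z + dot y z.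
Proof. by rewrite dotC dotDr !(dotC z). Qed.

Lemma dotZl x k y : dot (k *: x) y = k * dot x y.
Proof. by rewrite dotC dotZr dotC. Qed.

Lemma dotNl x y : dot (- x) y = - dot x y.
Proof. by rewrite -scaleN1r dotZl mulN1r. Qed.

Lemma dotNr x y : dot x (- y) = - dot x y.
Proof. by rewrite dotC dotNl dotC. Qed.

Lemma dotBl x y z : dot (x - y) z = dot x z - dot y z.
Proof. by rewrite dotDl dotNl. Qed.

Lemma dotBr x y z : dot x (y - z) = dot x y - dot x z.
Proof. by rewrite dotDr dotNr. Qed.

Lemma dot0l x : dot 0 x = 0.
Proof. by rewrite -(scale0r 0) dotZl mul0r. Qed.

Lemma dot0r x : dot x 0 = 0.
Proof. by rewrite dotC dot0l. Qed.

Lemma dot_sumr (I : Type) (s : seq I) (P : pred I) (F : I -> 'rV[R]_d) x :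
  dot x (\sum_(i <- s | P i) F i) = \sum_(i <- s | P i) dot x (F i).
Proof.
by elim/big_rec2: _ => [|i y z _ <-]; rewrite ?dot0r// dotDr.
Qed.

Lemma dot_suml (I : Type) (s : seq I) (P : pred I) (F : I -> 'rV[R]_d) x :
  dot (\sum_(i <- s | P i) F i) x = \sum_(i <- s | P i) dot (F i) x.
Proof. by rewrite dotC dot_sumr; apply: eq_bigr => i _; rewrite dotC. Qed.

Lemma dot_self_eq0 x : dot x x = 0 -> x = 0.
Proof.
move=> /eqP; rewrite psumr_eq0 => [/allP h|i _]; last by rewrite -expr2 sqr_ge0.
apply/rowP => i; rewrite mxE; apply/eqP.
by have := h i (mem_index_enum _); rewrite /= mulf_eq0 orbb.
Qed.

End Dot.

(** * The span of the [delta u], and functionals constant on tours *)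

Section Span.
Context {R : realType} {n : nat}.
Hypothesis hn : (5 <= n)%N.
Implicit Types (e : edge n) (u v w : 'I_n) (a b q : edge_space R n)
  (mu : 'I_n -> R) (c : seq 'I_n).

Let hn2 : (2 < n)%N. Proof. exact: leq_trans hn. Qed.

Let nR : (5%:R : R) <= n%:R. Proof. by rewrite ler_nat. Qed.

Definition dsum mu : edge_space R n := \sum_u mu u *: delta R u.

Lemma ev_dsum mu v w : v != w -> ev (dsum mu) v w = (mu v + mu w) / 2.
Proof.
move=> vw; rewrite /dsum ev_sum (bigD1 v)//= (bigD1 w) 1?eq_sym//= big1 => [|u /andP[uv uw]].
  rewrite !evZ !ev_delta// !eqxx orbT /=; lra.
by rewrite evZ ev_delta// (negbTE uv) (negbTE uw) mul0r mulr0.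
Qed.

Lemma dsumE mu f : (forall u, mu u = f u) -> dsum mu = dsum f.
Proof. by move=> h; apply: eq_bigr => u _; rewrite h. Qed.

Lemma dsumZ (k : R) mu : dsum (fun u => k * mu u) = k *: dsum mu.
Proof. by rewrite /dsum scaler_sumr; apply: eq_bigr => u _; rewrite scalerA. Qed.

Lemma dsumD mu nu : dsum (fun u => mu u + nu u) = dsum mu + dsum nu.
Proof. by rewrite /dsum -big_split; apply: eq_bigr => u _; rewrite scalerDl. Qed.

Lemma dot_delta_tour u c : hamilton_cycle c -> dot (delta R u) (tour c) = 1.
Proof. by move=> hc; rewrite tourE dot_delta_mvec deg_hamilton// divff. Qed.

Lemma dot_dsum mu x : dot (dsum mu) x = \sum_u mu u * dot (delta R u) x.
Proof. by rewrite dot_suml; apply: eq_bigr => u _; rewrite dotZl. Qed.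

Lemma dot_dsum_tour mu c : hamilton_cycle c -> dot (dsum mu) (tour c) = \sum_u mu u.
Proof.
by move=> hc; rewrite dot_dsum; apply: eq_bigr => u _; rewrite dot_delta_tour// mulr1.
Qed.

Lemma n1_gt0 : 0 < n%:R - 1 :> R.
Proof. by have := nR; lra. Qed.

Lemma dot_delta_z u : dot (delta R u) (zpoint R n) = 1.
Proof.
have : dot (delta R u) (zpoint R n) *+ 2 = 2.
  rewrite -sum_ev_delta (bigD1 u)//= evxx add0r.
  under eq_bigr => v vu.
    rewrite (_ : ev _ _ _ = 2 / (n%:R - 1)); last first.
      have [e eE] := edge_of vu; rewrite ev_sym (ev_edge _ eE) /coord mxE.
      by [].
    over.
  rewrite sumr_const.
  have -> : #|(fun i : 'I_n => i != u)| = n.-1.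
    by have := cardC1 u; rewrite card_ord.
  rewrite -[LHS]mulr_natr.
  have -> : n.-1%:R = n%:R - 1 :> R.
    by rewrite -subn1 natrB//; apply: leq_trans hn.
  by rewrite divfK// gt_eqF// n1_gt0.
by rewrite -mulr_natr; lra.
Qed.

Lemma dot_dsum_z mu : dot (dsum mu) (zpoint R n) = \sum_u mu u.
Proof. by rewrite dot_dsum; apply: eq_bigr => u _; rewrite dot_delta_z mulr1. Qed.

Lemma zpointE : zpoint R n = dsum (fun=> 2 / (n%:R - 1)).
Proof.
apply: ev_ext => u v uv; rewrite ev_dsum//.
have [e eE] := edge_of uv; rewrite (ev_edge _ eE) /coord mxE; lra.
Qed.

(* Solution of [dot_delta_dsum]: with this [mu], [dsum mu] and [a] have the same
   inner products with all the [delta u]. *)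
Definition pcoef a u : R :=
  (4 * dot (delta R u) a - 2 * (\sum_w dot (delta R w) a) / (n%:R - 1)) / (n%:R - 2).

Definition Lproj a : edge_space R n := a - dsum (pcoef a).

Lemma dot_delta_dsum mu u :
  dot (delta R u) (dsum mu) = ((n%:R - 2) * mu u + \sum_v mu v) / 4.
Proof.
suff : dot (delta R u) (dsum mu) *+ 2 = ((n%:R - 2) * mu u + \sum_v mu v) / 2.
  by rewrite -mulr_natr; lra.
rewrite -sum_ev_delta (bigD1 u)//= evxx add0r [in RHS](bigD1 u)//=.
rewrite (eq_bigr (fun v => (mu u + mu v) / 2)) => [|v vu]; last first.
  by rewrite ev_dsum// eq_sym.
rewrite -mulr_suml big_split /= sumr_const.
have -> : #|(fun i : 'I_n => i != u)| = n.-1.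
  by have := cardC1 u; rewrite card_ord.
rewrite -[mu u *+ _]mulr_natr.
have -> : n.-1%:R = n%:R - 1 :> R.
  by rewrite -subn1 natrB//; apply: leq_trans hn.
by lra.
Qed.

Lemma Lproj_Lspace a : Lspace R n (Lproj a).
Proof.
have n1 : n%:R - 1 != 0 :> R by rewrite gt_eqF// n1_gt0.
have n2 : n%:R - 2 != 0 :> R by rewrite gt_eqF//; have := nR; lra.
move=> u; rewrite /Lproj dotBr dot_delta_dsum.
have -> : \sum_v pcoef a v = 2 * (\sum_v dot (delta R v) a) / (n%:R - 1).
  rewrite /pcoef -mulr_suml sumrB -mulr_sumr sumr_const card_ord.
  set D := \sum_v _; rewrite -[_ *+ n]mulr_natr.
  by field; rewrite ?n1 ?n2.
rewrite /pcoef; set D := \sum_v _.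
by field; rewrite ?n1 ?n2.
Qed.

Lemma Lspace_dsum a mu : Lspace R n a -> dot (dsum mu) a = 0.
Proof. by move=> La; rewrite dot_dsum big1// => u _; rewrite La mulr0. Qed.

Lemma LperpP q : Lperp R n q <-> exists mu, q = dsum mu.
Proof.
split=> [hq|[mu ->] x Lx]; last exact: Lspace_dsum.
exists (pcoef q); apply/eqP; rewrite -subr_eq0; apply/eqP/dot_self_eq0.
rewrite -/(Lproj q) {1}/Lproj dotBl hq; last exact: Lproj_Lspace.
by rewrite Lspace_dsum ?subr0//; exact: Lproj_Lspace.
Qed.

Lemma Lspace_z a : Lspace R n a -> dot a (zpoint R n) = 0.
Proof. by move=> La; rewrite zpointE dotC Lspace_dsum. Qed.

Lemma Lspace_dsum_eq0 mu : Lspace R n (dsum mu) -> dsum mu = 0.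
Proof. by move=> h; apply: dot_self_eq0; rewrite Lspace_dsum. Qed.

(** The end [t] of [e] is kept out of the four vertices passed to [exchange], so [e] is none of the
    exchanged pairs. *)
Lemma tour_avoiding e : exists c, hamilton_cycle c /\ e \notin cycle_edges c.
Proof.
have [s [t [st eE]]] := edge_ends e.
have [p1 h1] := fresh hn (isT : (size [:: s; t] <= 4)%N).
have [p2 h2] := fresh hn (isT : (size [:: s; t; p1] <= 4)%N).
have [p3 h3] := fresh hn (isT : (size [:: s; t; p1; p2] <= 4)%N).
move: h1 h2 h3; rewrite !inE !negb_or => /andP[s1 t1] /and3P[s2 t2 h12] /and4P[s3 t3 h13 h23].
have bad x y : x != t -> y != t -> val e != [set x; y]%SET.
  move=> xt yt; apply/eqP => eE'; have : t \in val e by rewrite eE set22.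
  by rewrite eE' => /finset.set2P[] tE; rewrite tE eqxx in xt yt.
have [|||||c [c' [hc _ ec _ _]]] := @exchange n hn e s p1 p2 p3; rewrite ?bad//.
  by rewrite /= !inE !negb_or (eq_sym p2) !(eq_sym p1) !(eq_sym s) s1 s2 s3 h12 h13 h23.
by exists c.
Qed.

(** The four-point equalities of [exchange] make [a] a sum of vertex potentials away from [e]. The
    reference vertices [p1], [p2], [p3] are taken off [e]. *)
Lemma const_avoiding a e (K : R) :
  (forall c, hamilton_cycle c -> e \notin cycle_edges c -> dot a (tour c) = K) ->
  exists mu, forall u v, u != v -> val e != [set u; v]%SET -> ev a u v = (mu u + mu v) / 2.
Proof.
move=> aK.
have quad i j k l : uniq [:: i; j; k; l] ->
    val e != [set i; j]%SET -> val e != [set k; l]%SET ->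
    val e != [set i; k]%SET -> val e != [set j; l]%SET ->
    ev a i j + ev a k l = ev a i k + ev a j l.
  move=> uq e1 e2 e3 e4; have [c [c' [hc hc' ec ec' cE]]] := exchange hn uq e1 e2 e3 e4.
  by have := cE R a; rewrite !aK//; lra.
have [s [t [st eE]]] := edge_ends e.
have [p1 h1] := fresh hn (isT : (size [:: s; t] <= 4)%N).
have [p2 h2] := fresh hn (isT : (size [:: s; t; p1] <= 4)%N).
have [p3 h3] := fresh hn (isT : (size [:: s; t; p1; p2] <= 4)%N).
have off x y : x \notin [:: s; t] -> val e != [set x; y]%SET.
  rewrite !inE negb_or => /andP[xs xt]; apply/eqP => eE'.
  have : x \in val e by rewrite eE' set21.
  by rewrite eE => /finset.set2P[] xE; rewrite xE eqxx in xs xt.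
have offr x y : y \notin [:: s; t] -> val e != [set x; y]%SET.
  by rewrite finset.setUC; exact: off.
have h2' : p2 \notin [:: s; t] by move: h2; rewrite !inE !negb_or => /and3P[-> ->].
have h3' : p3 \notin [:: s; t] by move: h3; rewrite !inE !negb_or => /and4P[-> ->].
have p12 : p1 != p2 by move: h2; rewrite !inE !negb_or => /and3P[_ _]; rewrite eq_sym.
have p13 : p1 != p3 by move: h3; rewrite !inE !negb_or => /and4P[_ _ h _]; rewrite eq_sym.
have p23 : p2 != p3 by move: h3; rewrite !inE !negb_or => /and4P[_ _ _ h]; rewrite eq_sym.
(* The potential of [p1] is forced by the triangle [p1 p2 p3]; the others follow from the edges at
   [p1]. *)
pose l1 := ev a p1 p2 + ev a p1 p3 - ev a p2 p3.
exists (fun u => if u == p1 then l1 else 2 * ev a u p1 - l1).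
(* Each four-point equality used involves, besides [uv], only edges at some [p1], [p2] or [p3], none
   of which is [e]. *)
have main u v : u != v -> u != p1 -> v != p1 -> u != p2 -> u != p3 ->
    val e != [set u; v]%SET -> ev a u v = ev a u p1 + ev a v p1 - l1.
  move=> uv u1 v1 u2 u3 uve; rewrite /l1.
  have q3 w : w != p1 -> w != p2 -> w != p3 ->
      ev a w p2 + ev a p1 p3 = ev a w p1 + ev a p2 p3.
    move=> w1 w2 w3; apply: quad; [|exact: offr|exact: off|exact: offr|exact: off].
    by rewrite /= !inE !negb_or w1 w2 w3 [p2 == _]eq_sym p12 p13 p23.
  case: (eqVneq v p2) => [->|v2]; first by have := q3 _ u1 u2 u3; rewrite (ev_sym a p2 p1); lra.
  have : ev a u v + ev a p1 p2 = ev a u p1 + ev a v p2.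
    apply: quad; [|by []|exact: off|exact: offr|exact: offr].
    by rewrite /= !inE !negb_or uv u1 u2 v1 v2 p12.
  case: (eqVneq v p3) => [->|v3]; last by have := q3 _ v1 v2 v3; lra.
  by rewrite (ev_sym a p3 p1) (ev_sym a p3 p2); lra.
move=> u v uv uve; case: (eqVneq u p1) => [u1|u1].
  rewrite -u1 eq_sym (negbTE uv) (ev_sym a v u); lra.
case: (eqVneq v p1) => [->|v1]; first lra.
suff -> : ev a u v = ev a u p1 + ev a v p1 - l1 by lra.
have [/orP u23|] := boolP ((u == p2) || (u == p3)); last first.
  by rewrite negb_or => /andP[u2 u3]; exact: main.
have [/orP v23|] := boolP ((v == p2) || (v == p3)); last first.
  rewrite negb_or => /andP[v2 v3]; rewrite ev_sym main ?[v == u]eq_sym// 1?finset.setUC//.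
  lra.
rewrite /l1; move: u23 v23 uv => [/eqP->|/eqP->] [/eqP->|/eqP->]; rewrite ?eqxx// => _.
  by rewrite (ev_sym a p2 p1) (ev_sym a p3 p1); lra.
by rewrite (ev_sym a p2 p1) (ev_sym a p3 p1) (ev_sym a p3 p2); lra.
Qed.

Lemma dot_tour_next a c : hamilton_cycle c ->
  dot a (tour c) = \sum_(u <- c) ev a u (next c u).
Proof.
case: c => [|x p] hc.
  by exfalso; have := hn; rewrite -[X in (_ < X)%N](hamilton_size hc).
by rewrite dot_tour_walk// steps_next ?hc.1// /cost big_map.
Qed.

Definition ptour (s : {perm 'I_n}) := [seq s i | i <- enum 'I_n].

Lemma hamilton_ptour s : hamilton_cycle (ptour s).
Proof.
split=> [|u]; first by rewrite map_inj_uniq ?enum_uniq//; exact: perm_inj.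
by apply/mapP; exists ((s^-1)%g u); rewrite ?mem_enum ?permKV.
Qed.

Lemma hamilton_permP c : hamilton_cycle c -> exists s, c = ptour s.
Proof.
move=> hc; have sc := hamilton_size hc.
pose f (i : 'I_n) := nth i c i.
have fi : injective f.
  move=> i j; rewrite /f (set_nth_default j) ?sc// => /eqP.
  by rewrite nth_uniq ?sc ?hc.1// => /eqP/val_inj.
exists (perm fi); rewrite /ptour.
have n0 : (0 < n)%N by apply: leq_trans hn.
apply: (@eq_from_nth _ (Ordinal n0)); first by rewrite size_map size_enum_ord sc.
move=> i ic; have i_n : (i < n)%N by rewrite -sc.
rewrite (nth_map (Ordinal n0)) ?size_enum_ord// permE /f nth_enum_ord//.
exact: set_nth_default.
Qed.

(** This says that [zpoint] is the barycentre of the tours. By symmetry the sum [K i j] over all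
    permutations does not depend on [j != i], and its total over [j] vanishes for [b] in
    [Lspace]. *)
Lemma sum_tours b : Lspace R n b -> \sum_(s : {perm 'I_n}) dot b (tour (ptour s)) = 0.
Proof.
move=> Lb.
have he : hamilton_cycle (enum 'I_n) by split=> [|u]; rewrite ?enum_uniq ?mem_enum.
pose K i j := \sum_(s : {perm 'I_n}) ev b (s i) (s j).
have KK i j j' : j != i -> j' != i -> K i j = K i j'.
  move=> ji j'i; rewrite /K (reindex_inj (mulgI (tperm j j'))) /=.
  by apply: eq_bigr => s _; rewrite !permM tpermL tpermD.
have K0 i j : j != i -> K i j = 0.
  move=> ji; have : \sum_(j' | j' != i) K i j' = 0.
    have -> : \sum_(j' | j' != i) K i j' = \sum_j' K i j'.
      by rewrite [RHS](bigD1 i)//= [X in X + _]big1 ?add0r// => s _; exact: evxx.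
    rewrite exchange_big big1//= => s _.
    have := sum_ev_delta b (s i); rewrite Lb mul0rn.
    by rewrite (reindex_inj (@perm_inj _ s)).
  rewrite (eq_bigr (fun=> K i j)) => [|j' j'i]; last exact: KK.
  rewrite sumr_const => /eqP; rewrite mulrn_eq0 => /orP[|/eqP//].
  have := cardC1 i; rewrite card_ord => ->.
  by rewrite -subn1 subn_eq0 leqNgt ltnW// ltnW.
under eq_bigr => s _ do rewrite (dot_tour_next b (hamilton_ptour s)) big_map.
rewrite exchange_big big1_seq//= => i _.
rewrite (eq_bigr (fun s : {perm 'I_n} => ev b (s i) (s (next (enum 'I_n) i)))); last first.
  by move=> s _; rewrite /ptour next_map ?enum_uniq//; exact: perm_inj.
by apply: K0; apply: next_neq; rewrite ?enum_uniq ?size_enum_ord ?mem_enum// ltnW.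
Qed.

End Span.

(** * Faces of finitely generated polyhedra *)

Local Open Scope classical_set_scope.
Local Open Scope ring_scope.

Section Hulls.
Context {R : realType} {d : nat}.
Implicit Types (x y c : 'rV[R]_d) (A : set 'rV[R]_d) (b : R).

Lemma sub_hull A x : A x -> convex_hull A x.
Proof.
move=> Ax; exists 1%N, (fun=> 1), (fun=> x); split=> //; rewrite big_ord1//.
by rewrite scale1r.
Qed.

Lemma hull_valid A c b : valid c b A -> valid c b (convex_hull A).
Proof.
move=> cA x [k [w [p [w0 w1 Ap ->]]]]; rewrite dot_sumr -[b]mul1r -w1 mulr_suml.
by apply: ler_sum => i _; rewrite dotZr ler_wpM2l// cA.
Qed.

(** A convex combination is tight only if all its points of nonzero weight are. *)
Lemma hull_tight A c b c' b' : valid c b A ->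
  (forall x, A x -> dot c x = b -> dot c' x = b') ->
  forall x, convex_hull A x -> dot c x = b -> dot c' x = b'.
Proof.
move=> cA cc' x [k [w [p [w0 w1 Ap ->]]]] tx.
have : \sum_i w i * (dot c (p i) - b) = 0.
  under eq_bigr do rewrite mulrBr; rewrite sumrB -mulr_suml w1 mul1r -tx.
  by rewrite dot_sumr; under [X in X - _]eq_bigr do rewrite -dotZr; rewrite subrr.
move=> /eqP; rewrite psumr_eq0 => [/allP h|i _]; last first.
  by rewrite mulr_ge0// subr_ge0 cA.
rewrite dot_sumr -[RHS]mul1r -w1 mulr_suml; apply: eq_bigr => i _.
have := h i (mem_index_enum _); rewrite /= mulf_eq0 subr_eq0 dotZr => /orP[]/eqP hi.
  by rewrite hi !mul0r.
by rewrite (cc' _ (Ap i) hi).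
Qed.

End Hulls.

Section FinitePolyhedra.
Context {R : realType} {d : nat} {I : finType} (c : I -> 'rV[R]_d) (b : I -> R).
Implicit Types (x y : 'rV[R]_d) (F : set 'rV[R]_d).

Definition hpoly : set 'rV[R]_d := [set x | forall i, b i <= dot (c i) x].

Definition tsub x y := forall i, dot (c i) x = b i -> dot (c i) y = b i.

Lemma polyhedron_hpoly : polyhedron hpoly.
Proof.
exists #|I|, (c \o enum_val), (b \o enum_val); apply/seteqP; split=> x /= h i //.
by have := h (enum_rank i); rewrite enum_rankK.
Qed.

Lemma hpoly_extend x y : hpoly x -> hpoly y -> tsub x y ->
  exists2 e : R, 0 < e & hpoly (x + e *: (x - y)).
Proof.
move=> Qx Qy xy.
(* All lengths up to [e] are required, so that the minimum of two bounds serves both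
   inequalities. *)
suff [e e0 he] : exists2 e : R, 0 < e & forall i, i \in index_enum I ->
    forall f, 0 <= f <= e -> b i <= dot (c i) (x + f *: (x - y)).
  by exists e => // i; apply: he; rewrite ?mem_index_enum ?lexx ?ltW.
elim: (index_enum I) => [|i s [e e0 he]]; first by exists 1.
suff [g g0 hg] : exists2 g : R, 0 < g & forall f, 0 <= f <= g ->
    b i <= dot (c i) (x + f *: (x - y)).
  exists (Num.min e g) => [|j]; first by rewrite lt_min e0.
  rewrite inE => js f /andP[f0]; rewrite le_min => /andP[fe fg].
  by case/orP: js => [/eqP->|/he]; [apply: hg|apply]; rewrite f0.
have := Qx i; rewrite le_eqVlt => /orP[/eqP bi|bi].
  by exists 1 => // f _; rewrite dotDr dotZr dotBr (xy i)// -bi subrr mulr0 addr0.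
(* The slack at [x] over the speed at which it can be lost; adding 1 avoids a zero denominator. *)
exists ((dot (c i) x - b i) / (1 + `|dot (c i) (x - y)|)) => [|f /andP[f0]].
  by rewrite divr_gt0 ?subr_gt0// ltr_pwDl.
move=> h; rewrite dotDr dotZr; move: h; set D := dot (c i) (x - y).
rewrite ler_pdivlMr ?ltr_pwDl// => h.
have : f * - D <= f * `|D| by rewrite ler_wpM2l// -normrN ler_norm.
by move: h; rewrite mulrDr mulrN mulr1; lra.
Qed.

(** The segment from [y] to [x] continues beyond [x] inside the polyhedron. The functional exposing
    [F] is minimal at [x], an inner point of this longer segment, hence constant along it. *)
Lemma face_tsub F x y : face hpoly F -> F x -> hpoly y -> tsub x y -> F y.
Proof.
move=> [g [k [gk ->]]] [Qx gx] Qy xy; split=> //.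
have [e e0 Qe] := hpoly_extend Qx Qy xy.
have := gk _ Qe; rewrite dotDr dotZr dotBr gx; have := gk _ Qy => h1 h2.
have : 0 <= e * (k - dot g y) by lra.
by rewrite pmulr_rge0//; lra.
Qed.

Definition min_face x := [set y | hpoly y /\ tsub x y].

(** It is exposed by the sum of the inequalities tight at [x]: nonnegative slacks add up to 0 only
    if each is 0. *)
Lemma face_min_face x : hpoly x -> face hpoly (min_face x).
Proof.
move=> Qx; pose P i := dot (c i) x == b i.
exists (\sum_(i | P i) c i), (\sum_(i | P i) b i); split.
  by move=> y Qy; rewrite dot_suml; apply: ler_sum.
apply/seteqP; split=> y [Qy h]; split=> //.
  by rewrite dot_suml; apply: eq_bigr => i /eqP; exact: h.
move=> i /eqP Pi; move: h => /eqP; rewrite -subr_eq0 dot_suml -sumrB.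
rewrite psumr_eq0 => [/allP/(_ i (mem_index_enum _))|j _]; last by rewrite subr_ge0.
by rewrite [P i]Pi /= subr_eq0 => /eqP.
Qed.

(** An inequality is tight at a midpoint only if it is tight at both ends. Moving halfway towards a
    point of [F] with slack thus removes one tight inequality and adds none. *)
Lemma face_relint F : face hpoly F -> F !=set0 ->
  exists x, F x /\ F = min_face x.
Proof.
move=> fF [x0 Fx0]; suff [x Fx hx] : exists2 x, F x & forall y, F y -> tsub x y.
  exists x; split=> //; apply/seteqP; split=> [y Fy|y [Qy xy]].
    by split; [move: Fy; case: fF => g [k [_ ->]] []|exact: hx].
  exact: face_tsub fF Fx Qy xy.
suff [x Fx hx] : exists2 x, F x & forall i, i \in index_enum I ->
    dot (c i) x = b i -> forall y, F y -> dot (c i) y = b i.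
  by exists x => // y Fy i xi; apply: hx; rewrite ?mem_index_enum.
have FQ y : F y -> hpoly y by case: fF => g [k [_ ->]] [].
elim: (index_enum I) => [|i s [x Fx hx]]; first by exists x0.
have [[y Fy yi]|ny] := pselect (exists2 y, F y & dot (c i) y <> b i); last first.
  exists x => // j; rewrite inE => /orP[/eqP->|/hx//] _ y Fy.
  by apply: contrapT => yi; apply: ny; exists y.
have dm j : dot (c j) (2^-1 *: (x + y)) = (dot (c j) x + dot (c j) y) / 2.
  by rewrite dotZr dotDr mulrC.
exists (2^-1 *: (x + y)).
  case: fF Fx Fy => g [k [_ ->]] [Qx gx] [Qy gy]; split; last first.
    by rewrite dotZr dotDr gx gy; lra.
  by move=> j; rewrite dm; have := Qx j; have := Qy j; lra.
move=> j js; rewrite dm => tj.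
have := FQ _ Fx j; have := FQ _ Fy j => h1 h2.
have tx : dot (c j) x = b j by lra.
have ty : dot (c j) y = b j by lra.
move: js; rewrite inE => /orP[/eqP ji|/hx]; last by apply.
by case: yi; rewrite -ji.
Qed.

End FinitePolyhedra.

(** * Closed and bounded sets of row vectors *)

Section RowTopology.
Context {R : realType} {d : nat}.
Implicit Types (x c : 'rV[R]_d).

Lemma dot_continuous c : continuous (dot c : 'rV[R]_d -> R).
Proof.
apply: continuous_big => [|i _ x]; first exact: add_continuous.
have := @cvgM R _ (nbhs (x : 'rV[R]_d)) _ (fun=> c ord0 i)
  (fun y : 'rV[R]_d => y ord0 i) _ _ (cvg_cst _) (@coord_continuous _ _ _ _ _ x).
exact.
Qed.

Lemma closed_polyhedron (Q : set 'rV[R]_d) : polyhedron Q -> closed Q.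
Proof.
move=> [m [c [b ->]]].
have -> : [set x | forall i, b i <= dot (c i) x] =
    \bigcap_(i in [set: 'I_m]) (dot (c i) @^-1` [set t | b i <= t]).
  by apply/seteqP; split=> x h i => [_|]; exact: h.
apply: closed_bigI => i _; apply: closed_comp; last exact: closed_ge.
by move=> x _; exact: dot_continuous.
Qed.

Lemma coord_le_norm x i : `|x ord0 i| <= `|x|.
Proof.
rewrite [leRHS]/Num.norm /= mx_normrE; apply/bigmax_geP; right => /=.
by exists (ord0, i).
Qed.

Lemma norm_le_coord x (M : R) : 0 <= M -> (forall i, `|x ord0 i| <= M) -> `|x| <= M.
Proof.
move=> M0 h; rewrite [leLHS]/Num.norm /= mx_normrE; apply/bigmax_leP; split=> //.
by move=> [k i] _ /=; rewrite ord1.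
Qed.

Lemma bounded_ray (F : set 'rV[R]_d) x v : bounded_set F ->
  (forall t : R, 0 <= t -> F (x + t *: v)) -> v = 0.
Proof.
move=> /pinfty_ex_gt0[M M0 hM] hF; apply/rowP => i; rewrite mxE.
apply: contrapT => /eqP vi0.
pose t := (M + 1 + `|x ord0 i|) / `|v ord0 i|.
have v0 : 0 < `|v ord0 i| by rewrite normr_gt0.
have t0 : 0 <= t by rewrite divr_ge0// !addr_ge0// ltW.
have := le_trans (coord_le_norm (x + t *: v) i) (hM _ (hF t t0)).
rewrite !mxE leNgt => /negP; apply.
have h1 : `|t * v ord0 i| = M + 1 + `|x ord0 i|.
  by rewrite normrM (ger0_norm t0) /t divfK// gt_eqF.
have := ler_normB (x ord0 i + t * v ord0 i) (x ord0 i).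
rewrite [X in `|X| <= _]addrAC subrr add0r h1; lra.
Qed.

Lemma polyhedron_linear (I : finType) (f : I -> 'rV[R]_d -> R) (b : I -> R) :
  (forall i k x y, f i (k *: x + y) = k * f i x + f i y) ->
  polyhedron [set x | forall i, b i <= f i x].
Proof.
move=> lf; pose c i : 'rV[R]_d := \row_j f i (delta_mx 0 j).
rewrite (_ : [set x | _] = hpoly c b); first exact: polyhedron_hpoly.
have f0 i : f i 0 = 0 by have := lf i 1 0 0; rewrite scale1r addr0 mul1r; lra.
have fE i x : f i x = dot (c i) x.
  rewrite [in LHS](row_sum_delta x) /dot.
  elim/big_rec2: _ => [//|j y1 y2 _ <-]; rewrite lf mxE mulrC; congr (_ + _).
by apply/seteqP; split=> x h i; have := h i; rewrite ?fE -?fE.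
Qed.

End RowTopology.

(** * Inequalities defining the polar of [GTSP] *)

Section GoodMultigraphs.
Context {n : nat}.
Implicit Types (e : edge n) (u v w : 'I_n) (m : edge n -> nat).

(** Connectedness depends on the support only, and Eulerianness on the parities only. *)
Lemma good_supp m1 m2 : (forall e, (0 < m1 e)%N -> (0 < m2 e)%N) ->
  (forall e, odd (m1 e) = odd (m2 e)) -> good m1 -> good m2.
Proof.
move=> h odd12 [cm em]; split=> [u v|u].
  apply: (connect_sub (e := adj m1)); last exact: cm.
  move=> x y /fintype.existsP[e /andP[/h me eE]]; apply: connect1.
  by apply/fintype.existsP; exists e; rewrite me.
have := em u; rewrite -!/(deg _ u) /deg.
rewrite !(big_morph odd oddD (erefl : odd 0 = false)).
by under eq_bigr do rewrite odd12.
Qed.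

(** The least multiplicities with the same support and parities as [m]; they reduce [GTSP_polar] to
    finitely many inequalities. *)
Definition reduce m e : nat := if (m e <= 2)%N then m e else if odd (m e) then 1%N else 2.

Lemma reduce_le m e : (reduce m e <= m e)%N.
Proof. by rewrite /reduce; case: ifP => //; case: ifP; lia. Qed.

Lemma reduce_le2 m e : (reduce m e < 3)%N.
Proof. by rewrite /reduce; case: ifP => //; case: ifP; lia. Qed.

Lemma reduce_gt0 m e : (0 < m e)%N -> (0 < reduce m e)%N.
Proof. by rewrite /reduce; case: ifP => //; case: ifP. Qed.

Lemma good_reduce m : good m -> good (reduce m).
Proof.
apply: good_supp => e; first exact: reduce_gt0.
by rewrite /reduce; case: ifP => //; case: ifP.
Qed.

Lemma good_addn2 m e k : good m -> good (fun f => m f + (f == e) * k.*2)%N.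
Proof.
apply: good_supp => f; first by rewrite addn_gt0 => ->.
by rewrite oddD oddM odd_double andbF addbF.
Qed.

Lemma deg_gt0 m e u : (0 < m e)%N -> u \in val e -> (0 < deg m u)%N.
Proof. by move=> me ue; rewrite /deg (bigD1 e)//= addn_gt0 me. Qed.

Lemma good_deg_ge2 m u : (1 < n)%N -> good m -> (2 <= deg m u)%N.
Proof.
move=> n1 gm; have [y [q [lq ndq hq mq]]] := euler_walk u gm.
have [v uv] : exists v, v != u.
  have : (0 < #|predC1 u|)%N by rewrite cardC1 card_ord -subn1 subn_gt0.
  by move=> /card_gt0P[v]; rewrite inE; exists v.
have d0 : (0 < deg m u)%N.
  have /connectP[p] := gm.1 u v.
  case: p => [_ /= vu|w p /= /andP[/fintype.existsP[e /andP[me /eqP eE]] _] _].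
    by rewrite vu eqxx in uv.
  by apply: (deg_gt0 me); rewrite [val e]eE set21.
by have := gm.2 u; rewrite -/(deg m u); case: (deg m u) d0 => [|[]].
Qed.

Lemma good_edge m : (1 < n)%N -> good m -> exists e, (0 < m e)%N.
Proof.
move=> n1 gm; have := good_deg_ge2 (Ordinal n1) n1 gm; rewrite /deg => h.
have : (0 < \sum_(e : edge n | Ordinal n1 \in val e) m e)%N by exact: ltnW.
rewrite lt0n sum_nat_eq0 negb_forall => /fintype.existsP[e].
by rewrite negb_imply -lt0n => /andP[_ me]; exists e.
Qed.

End GoodMultigraphs.

Section Polars.
Context {R : realType} {n : nat}.
Hypothesis hn : (5 <= n)%N.
Implicit Types (e : edge n) (u v w : 'I_n) (a b q : edge_space R n)
  (mu : 'I_n -> R) (c : seq 'I_n) (m : edge n -> nat).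

Let hn2 : (2 < n)%N. Proof. exact: leq_trans hn. Qed.
Let hn1 : (1 < n)%N. Proof. exact: leq_trans hn. Qed.

Lemma hamilton_enum : hamilton_cycle (enum 'I_n).
Proof. by split=> [|u]; rewrite ?enum_uniq ?mem_enum. Qed.

Lemma GTSP_mvec m : good m -> GTSP R n (mvec m).
Proof. by move=> [cm em]; apply: sub_hull; exists m. Qed.

Lemma GTSP_valid a (k : R) :
  valid a k (GTSP R n) <-> forall m, good m -> k <= dot a (mvec m).
Proof.
split=> [h m /GTSP_mvec/h//|h]; apply: hull_valid => _ [m [cm em ->]].
exact: (h m (conj cm em)).
Qed.

Lemma GTSP_tight a (k : R) a' (k' : R) : valid a k (GTSP R n) ->
  (forall m, good m -> dot a (mvec m) = k -> dot a' (mvec m) = k') ->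
  forall x, GTSP R n x -> dot a x = k -> dot a' x = k'.
Proof.
move=> va h; apply: hull_tight => x Ax; last first.
  by case: Ax => m [cm em ->]; exact: (h m (conj cm em)).
exact: va (sub_hull Ax).
Qed.

Lemma STSP_tour c : hamilton_cycle c -> STSP R n (tour c).
Proof. by move=> hc; apply: sub_hull; exists c. Qed.

Lemma STSP_valid a (k : R) : valid a k (STSP R n) <->
  forall c, hamilton_cycle c -> k <= dot a (tour c).
Proof.
split=> [h c /STSP_tour/h//|h]; apply: hull_valid => _ [c [hc ->]]; exact: h.
Qed.

Lemma STSP_const a (k : R) : (forall x, STSP R n x -> dot a x = k) <->
  forall c, hamilton_cycle c -> dot a (tour c) = k.
Proof.
split=> [h c /STSP_tour/h//|h x Sx]; apply/eqP; rewrite eq_le; apply/andP; split.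
  rewrite -[k]opprK lerNr -dotNl; move: x Sx; apply/STSP_valid => c hc.
  by rewrite dotNl h.
by move: x Sx; apply/STSP_valid => c hc; rewrite h.
Qed.

Lemma dot_mvec1 a e : dot a (mvec (fun f => f == e)) = coord a e.
Proof.
by rewrite dot_mvec (bigD1 e)//= eqxx mulr1 big1 ?addr0// => f /negbTE ->; rewrite mulr0.
Qed.

Lemma GTSP_polarP a : GTSP_polar R n a <-> forall m, good m -> 1 <= dot a (mvec m).
Proof. exact: GTSP_valid. Qed.

Lemma dot_addn2 a m e k : dot a (mvec (fun f => m f + (f == e) * k.*2)%N) =
  dot a (mvec m) + coord a e * k.*2%:R.
Proof.
rewrite dot_mvecD; congr (_ + _).
rewrite -(dot_mvec1 a e) !dot_mvec mulr_suml; apply: eq_bigr => f _.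
by rewrite natrM mulrA.
Qed.

(** Adding an even number of copies of [e] keeps a multigraph connected and Eulerian, so a negative
    coordinate would give arbitrarily small values. *)
Lemma GTSP_polar_ge0 a e : GTSP_polar R n a -> 0 <= coord a e.
Proof.
move=> /GTSP_polarP Pa; rewrite leNgt; apply/negP => ae.
have gm := hamilton_good hn2 hamilton_enum.
set m := (fun f => _) in gm.
set k := Num.bound (`|dot a (mvec m)| / - coord a e).
have := Pa _ (good_addn2 e k gm); rewrite dot_addn2 leNgt => /negP; apply.
have an : 0 < - coord a e by rewrite oppr_gt0.
have : `|dot a (mvec m)| / - coord a e < k%:R.
  by apply: archi_boundP; rewrite divr_ge0// ltW.
rewrite ltr_pdivrMr// -muln2 natrM => h.
have := ler_norm (dot a (mvec m)).
have : (k%:R : R) * - coord a e >= 0 by rewrite mulr_ge0// ltW.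
by rewrite mulrN => ? ?; move: h; rewrite mulrN; lra.
Qed.

Lemma dot_reduce a m : (forall e, 0 <= coord a e) ->
  dot a (mvec (reduce m)) <= dot a (mvec m).
Proof.
move=> a0; rewrite !dot_mvec; apply: ler_sum => e _.
by rewrite ler_wpM2l// ler_nat reduce_le.
Qed.

(* Finitely many inequalities defining [GTSP_polar]: nonnegativity, and one for
   each connected Eulerian multigraph with multiplicities at most [2]. *)
Definition pidx : finType :=
  (edge n + {m : {ffun edge n -> 'I_3} | `[< good (fun e => m e : nat) >]})%type.

Definition pnormal (i : pidx) : edge_space R n :=
  match i with
  | inl e => mvec (fun f => f == e)
  | inr m => mvec (fun e => val m e)
  end.

Definition prhs (i : pidx) : R := if i is inr _ then 1 else 0.

Lemma pidx_reduce m : good m ->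
  exists i : pidx, pnormal i = mvec (reduce m) /\ prhs i = 1.
Proof.
move=> gm; pose r := [ffun e => inord (reduce m e) : 'I_3].
have rE : (fun e => r e : nat) = reduce m.
  by apply/funext => e; rewrite ffunE inordK// reduce_le2.
have gr : `[< good (fun e => r e : nat) >] by apply/asboolP; rewrite rE; exact: good_reduce.
by exists (inr (exist _ r gr)); rewrite /= rE.
Qed.

Lemma hpoly_GTSP_polar : GTSP_polar R n = hpoly pnormal prhs.
Proof.
apply/seteqP; split=> a.
  move=> Pa [e|[m /asboolP gm]] /=; rewrite dotC ?dot_mvec1; first exact: GTSP_polar_ge0.
  by have /GTSP_polarP := Pa; apply.
move=> ha; apply/GTSP_polarP => m gm.
have a0 e : 0 <= coord a e by have := ha (inl e); rewrite /= dotC dot_mvec1.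
have [i [iE rE]] := pidx_reduce gm.
by apply: le_trans (dot_reduce m a0); have := ha i; rewrite iE rE dotC.
Qed.

(** For points of [GTSP_polar] this is inclusion of the faces of [GTSP] they define ([tight_setS]),
    and so the reverse order of the faces of the polar. *)
Definition tight_le a a' := forall m, good m -> dot a (mvec m) = 1 -> dot a' (mvec m) = 1.

Lemma reduce_tight a m : GTSP_polar R n a -> good m -> dot a (mvec m) = 1 ->
  dot a (mvec (reduce m)) = 1.
Proof.
move=> Pa gm tm; apply/eqP; rewrite eq_le.
have /GTSP_polarP -> := Pa; last exact: good_reduce.
by rewrite -tm dot_reduce// => e; exact: GTSP_polar_ge0.
Qed.

(** If [m] is tight for [a], so is [reduce m], and [a] is 0 on the edges where they differ. These
    zeros are tight inequalities too, hence pass to [a']. *)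
Lemma tsub_tight_le a a' : GTSP_polar R n a -> GTSP_polar R n a' ->
  tsub pnormal prhs a a' -> tight_le a a'.
Proof.
move=> Pa Pa' h m gm tm; have tr := reduce_tight Pa gm tm.
have [i [iE rE]] := pidx_reduce gm.
have := h i; rewrite iE rE !(dotC (mvec _)) => /(_ tr) <-.
apply/eqP; rewrite -subr_eq0 !dot_mvec -sumrB; apply/eqP; apply: big1 => e _.
have : \sum_(e : edge n) (coord a e * (m e)%:R - coord a e * (reduce m e)%:R) = 0.
  by rewrite sumrB -!dot_mvec tm tr subrr.
move=> /eqP; rewrite psumr_eq0 => [/allP/(_ e (mem_index_enum _))|f _]; last first.
  by rewrite -mulrBr mulr_ge0 ?GTSP_polar_ge0// subr_ge0 ler_nat reduce_le.
rewrite /= -!mulrBr !mulf_eq0 => /orP[/eqP ae|/eqP ->]; last by rewrite mulr0.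
have := h (inl e); rewrite /= !(dotC (mvec _)) !dot_mvec1 => -> //.
by rewrite mul0r.
Qed.

(** A zero coordinate is detected by adding two copies of the edge to a tight multigraph; this is
    why one is assumed. *)
Lemma tight_le_tsub a a' m : good m -> dot a (mvec m) = 1 -> tight_le a a' ->
  tsub pnormal prhs a a'.
Proof.
move=> gm tm h [e|[r /asboolP gr]] /=; rewrite !(dotC (mvec _)); last exact: h.
rewrite !dot_mvec1 => ae; have := h _ (good_addn2 e 1 gm).
rewrite !dot_addn2 ae mul0r addr0 (h _ gm tm) => /(_ tm)/eqP.
by rewrite -subr_eq0 addrAC subrr add0r mulf_eq0 pnatr_eq0 orbF => /eqP.
Qed.

End Polars.

(** * Tight triangular form *)

Section TightTriangles.
Context {R : realType} {n : nat}.
Hypothesis hn : (5 <= n)%N.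
Implicit Types (e : edge n) (u v w : 'I_n) (a b q : edge_space R n)
  (mu nu : 'I_n -> R) (c : seq 'I_n) (m : edge n -> nat).

Let hn2 : (2 < n)%N. Proof. exact: leq_trans hn. Qed.
Let hn1 : (1 < n)%N. Proof. exact: leq_trans hn. Qed.

Definition triangle u (p : 'I_n * 'I_n) := [&& u != p.1, u != p.2 & p.1 != p.2].

Definition gap b u (p : 'I_n * 'I_n) : R := ev b p.1 p.2 - ev b u p.1 - ev b u p.2.

(* The starting value is a lower bound of all the gaps, so that the maximum is
   attained at a triangle. *)
Definition mu b u : R :=
  \big[Num.max/ - \sum_p `|gap b u p|]_(p | triangle u p) gap b u p.

Definition tight_at a u := exists2 p, triangle u p & ev a p.1 p.2 = ev a u p.1 + ev a u p.2.

Definition TT a := metric a /\ forall u, tight_at a u.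

Lemma triangle_ex u : exists p, triangle u p.
Proof.
have [v hv] := fresh hn (isT : (size [:: u] <= 4)%N).
have [w hw] := fresh hn (isT : (size [:: u; v] <= 4)%N).
exists (v, w); move: hv hw; rewrite /triangle !inE !negb_or /= ![_ == u]eq_sym.
by move=> -> /andP[->]; rewrite eq_sym.
Qed.

Lemma gap_le_mu b u p : triangle u p -> gap b u p <= mu b u.
Proof. by move=> tp; rewrite /mu; exact: le_bigmax_cond. Qed.

Lemma mu_attained b u : exists2 p, triangle u p & mu b u = gap b u p.
Proof.
have [p tp] := triangle_ex u; rewrite /mu.
have [|q tq ->] := @eq_bigmax _ R _ (- \sum_p `|gap b u p|) p (triangle u) (gap b u) tp.
  move=> q _; rewrite lerNl (bigD1 q)//=.
  apply: ler_wpDr; first by apply: sumr_ge0 => *; exact: normr_ge0.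
  by rewrite -normrN ler_norm.
by exists q.
Qed.

(** Adding the triangle inequalities with apices [u] and [v] and common third vertex [w] gives
    nonnegativity on [uv], which settles the degenerate triples. *)
Lemma metric_triangles a :
  (forall u p, triangle u p -> ev a p.1 p.2 <= ev a u p.1 + ev a u p.2) -> metric a.
Proof.
move=> h.
have a0 u v : 0 <= ev a u v.
  case: (eqVneq u v) => [->|uv]; first by rewrite evxx.
  have [w hw] := fresh hn (isT : (size [:: u; v] <= 4)%N).
  move: hw; rewrite !inE negb_or ![w == _]eq_sym => /andP[uw vw].
  have := h u (v, w); have := h v (u, w); rewrite /triangle /= uv uw vw eq_sym uv /=.
  by move=> /(_ isT) h1 /(_ isT); rewrite (ev_sym a v u) in h1; lra.
move=> u v w; have := a0 u w; have := a0 w v.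
case: (eqVneq u v) => [->|uv]; first by rewrite evxx; lra.
case: (eqVneq w u) => [->|wu]; first by rewrite evxx; lra.
case: (eqVneq w v) => [->|wv]; first by rewrite evxx; lra.
by move=> _ _; rewrite (ev_sym a u w); apply: (h w (u, v)); rewrite /triangle /= wu wv.
Qed.

Lemma ev_add_dsum b nu v w : v != w ->
  ev (b + dsum nu) v w = ev b v w + (nu v + nu w) / 2.
Proof. by move=> vw; rewrite evD ev_dsum. Qed.

(** The contributions of [nu] at [p.1] and [p.2] cancel. So the triangles with apex [u] concern the
    coefficient of [delta u] alone, and the coefficients can be chosen independently. *)
Lemma triangle_add_dsum b nu u p : triangle u p ->
  ev (b + dsum nu) u p.1 + ev (b + dsum nu) u p.2 - ev (b + dsum nu) p.1 p.2 =
  nu u - gap b u p.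
Proof. by move=> /and3P[u1 u2 p12]; rewrite !ev_add_dsum// /gap; lra. Qed.

Lemma TT_add_mu b : TT (b + dsum (mu b)).
Proof.
split=> [|u].
  apply: metric_triangles => u p tp.
  by have := triangle_add_dsum b (mu b) tp; have := gap_le_mu b tp; lra.
have [p tp mE] := mu_attained b u; exists p => //.
by have := triangle_add_dsum b (mu b) tp; lra.
Qed.

Lemma tight_mu b nu u p : metric (b + dsum nu) -> triangle u p ->
  ev (b + dsum nu) p.1 p.2 = ev (b + dsum nu) u p.1 + ev (b + dsum nu) u p.2 ->
  nu u = gap b u p /\ mu b u = gap b u p.
Proof.
move=> mb tp tE; have := triangle_add_dsum b nu tp.
have nuE : nu u = gap b u p by have := triangle_add_dsum b nu tp; lra.
move=> _; split=> //; apply/eqP; rewrite eq_le gap_le_mu// andbT.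
have [q tq ->] := mu_attained b u.
have := triangle_add_dsum b nu tq; have := mb q.1 q.2 u.
by rewrite (ev_sym _ q.1 u); lra.
Qed.

Lemma TT_mu b nu : TT (b + dsum nu) -> mu b =1 nu.
Proof. by case=> mb tb u; have [p tp /(tight_mu mb tp)[-> ->]] := tb u. Qed.

Lemma TT_scale a (k : R) : 0 < k -> TT a -> TT (k *: a).
Proof.
move=> k0 [ma ta]; split=> [u v w|u]; first by rewrite !evZ -mulrDr ler_pM2l.
by have [p tp pE] := ta u; exists p; rewrite ?evZ ?pE ?mulrDr.
Qed.

(** For any edge [e], [const_avoiding] leaves only a multiple of the unit vector of [e]
    undetermined; comparing a tour through [e] with one avoiding [e] shows that it is 0. *)
Lemma tour_const_dsum a : (forall c, hamilton_cycle c -> dot a (tour c) = 1) ->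
  exists nu, a = dsum nu /\ \sum_u nu u = 1.
Proof.
move=> a1; have n0 : (0 < n)%N by exact: leq_trans hn.
have [e _] := good_edge hn1 (hamilton_good hn2 (@hamilton_enum n)).
have [nu nuE] := const_avoiding hn (fun c hc (_ : e \notin cycle_edges c) => a1 c hc).
have aE : a = dsum nu + (coord a e - coord (dsum nu) e) *: mvec (fun f => f == e).
  apply: coord_ext => f; rewrite coordD coordZ coord_mvec.
  case: (eqVneq f e) => [->|fe]; first by rewrite mulr1; lra.
  rewrite mulr0 addr0; have [u [v [uv fE]]] := edge_ends f.
  rewrite -!(ev_edge _ fE) ev_dsum// nuE// -fE.
  by apply: contra_neq fe => ?; exact: val_inj.
(* With the zero metric, and two copies of [e] added to some tour, [tour_through] just provides a
   tour using [e]. *)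
have m0 : metric (0 : edge_space R n).
  by move=> u v w; rewrite -(scale0r 0) !evZ !mul0r addr0.
have [|c1 [hc1 ec1 _]] := tour_through hn2 m0 (e := e)
  (good_addn2 e 1 (hamilton_good hn2 (@hamilton_enum n))).
  by rewrite eqxx addnC.
have [c2 [hc2 ec2]] := tour_avoiding hn e.
have de c : dot (mvec (fun f => f == e)) (tour c) = (e \in cycle_edges c)%:R :> R.
  by rewrite dotC dot_mvec1 tourE coord_mvec.
have := a1 _ hc2; have := a1 _ hc1.
rewrite aE !dotDl !dotZl !de !dot_dsum_tour// ec1 (negbTE ec2) mulr0 mulr1 addr0.
move=> h1 h2; exists nu; split=> //.
by rewrite (_ : _ - _ = 0) ?scale0r ?addr0//; lra.
Qed.

(** A tight triangle with apex [u] in [dsum nu] gives [nu u = 0], against the total 1. *)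
Lemma tour_const_not_tight a : (forall c, hamilton_cycle c -> dot a (tour c) = 1) ->
  ~ forall u, tight_at a u.
Proof.
move=> /tour_const_dsum[nu [-> nu1]] ta.
suff : \sum_u nu u = 0 by lra.
apply: big1 => u _; have [p /and3P[u1 u2 p12]] := ta u.
by rewrite !ev_dsum//; lra.
Qed.

Definition supported a := forall e, exists m,
  [/\ good m, dot a (mvec m) = 1 & (0 < m e)%N].

Definition branched a := forall u, exists m,
  [/\ good m, dot a (mvec m) = 1 & (2 < deg m u)%N].

(** The points of the carrier of [GTSP_deletion], by [carrier_GTSP_deletion]. *)
Definition GTSP_domain a := [/\ GTSP_polar R n a, supported a & branched a].

Lemma dot_detour_triangle m e u p : good m -> (0 < m e)%N ->
  val e = [set p.1; p.2]%SET -> exists m', good m' /\ forall a,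
  dot a (mvec m') = dot a (mvec m) + ev a u p.1 + ev a u p.2 - ev a p.1 p.2.
Proof.
move=> gm me eE; have [m' [gm' h]] := dot_detour (R := R) u gm me eE.
by exists m'; split=> // a; rewrite h (ev_sym a p.1 u).
Qed.

Lemma supported_metric a : GTSP_polar R n a -> supported a -> metric a.
Proof.
move=> Pa sa; apply: metric_triangles => u p /and3P[_ _ p12].
have [e eE] := edge_of p12; have [m [gm tm me]] := sa e.
have [m' [gm' h]] := dot_detour_triangle u gm me eE.
by have /GTSP_polarP/(_ _ gm') := Pa; rewrite h tm; lra.
Qed.

Lemma GTSP_domain_TT a : GTSP_domain a -> TT a.
Proof.
case=> Pa sa ba; have ma := supported_metric Pa sa; split=> // u.
have [m [gm tm dm]] := ba u.
have [v [w [m' [uv uw gm' h]]]] := dot_shortcut (R := R) gm dm.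
have := (GTSP_polarP a).1 Pa _ gm'; rewrite h tm => h'.
have [vw|vw] := eqVneq v w; last first.
  exists (v, w); first by rewrite /triangle /= uv uw.
  apply/eqP; rewrite eq_le /=; have := ma v w u; rewrite (ev_sym a v u) => -> /=.
  by move: h'; rewrite (ev_sym a v u); lra.
(* For [v = w] the shortcut drops two copies of [uv], so [a] is 0 on [uv] and every triangle with
   apex [u] and another vertex [v] is tight. *)
have [t ht] := fresh hn (isT : (size [:: u; v] <= 4)%N).
move: ht; rewrite !inE negb_or ![t == _]eq_sym => /andP[ut vt].
exists (v, t); first by rewrite /triangle /= uv ut.
have a0 : ev a u v = 0.
  apply/eqP; rewrite eq_le metric_ge0// andbT.
  by move: h'; rewrite -vw evxx (ev_sym a v u); lra.
rewrite /= a0 add0r; apply/eqP; rewrite eq_le.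
have := ma v t u; have := ma u t v; rewrite (ev_sym a v u) a0 !add0r.
by move=> -> ->.
Qed.

(** A tight multigraph through [p.1 p.2] and its detour via [u] are both tight for [a], hence for
    [a']; their difference is the triangle equality. *)
Lemma tight_tight_le a a' u p : supported a -> tight_le a a' -> triangle u p ->
  ev a p.1 p.2 = ev a u p.1 + ev a u p.2 ->
  ev a' p.1 p.2 = ev a' u p.1 + ev a' u p.2.
Proof.
move=> sa h /and3P[_ _ p12] tE; have [e eE] := edge_of p12.
have [m [gm tm me]] := sa e.
have [m' [gm' h']] := dot_detour_triangle u gm me eE.
have := h _ gm tm; have := h _ gm'; rewrite !h' tm tE.
by move=> /(_ _) h1 h2; have := h1 ltac:(lra); lra.
Qed.

Lemma tight_at_tight_le a a' u : supported a -> tight_le a a' -> tight_at a u -> tight_at a' u.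
Proof. by move=> sa h [p tp pE]; exists p => //; exact: tight_tight_le pE. Qed.

(** The points of the carrier of [STSP_deletion], by [carrier_STSP_deletion]. *)
Definition STSP_domain b := [/\ Lspace R n b,
  forall c, hamilton_cycle c -> -1 <= dot b (tour c) &
  forall e, exists c, [/\ hamilton_cycle c, e \in cycle_edges c & dot b (tour c) = -1]].

Definition polar_map a : edge_space R n := (dot a (zpoint R n) - 1)^-1 *: Lproj a.

(** The factor normalises tight tours to value 1: on them [b] is -1, and [dsum (mu b)] is the sum of
    [mu b] on every tour. *)
Definition polar_inv b : edge_space R n :=
  (\sum_u mu b u - 1)^-1 *: (b + dsum (mu b)).

Lemma Lproj_add_dsum b nu : Lspace R n b -> Lproj (b + dsum nu) = b.
Proof.
move=> Lb; apply/eqP; rewrite -subr_eq0; apply/eqP.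
set c := pcoef (b + dsum nu).
have E : Lproj (b + dsum nu) - b = dsum (fun u => nu u + -1 * c u).
  by rewrite dsumD dsumZ scaleN1r /Lproj -/c addrAC [b + _]addrC addrK.
rewrite E; apply: Lspace_dsum_eq0 => //; rewrite -E => u.
by rewrite dotBr Lproj_Lspace// Lb subrr.
Qed.

Lemma LprojE a : a = Lproj a + dsum (pcoef a).
Proof. by rewrite /Lproj subrK. Qed.

Lemma dot_z_proj a : dot a (zpoint R n) = \sum_u pcoef a u.
Proof.
rewrite {1}(LprojE a) dotDl (Lspace_z (Lproj_Lspace hn a)) add0r.
exact: dot_dsum_z.
Qed.

Lemma dot_tour_proj a c : hamilton_cycle c ->
  dot a (tour c) = dot (Lproj a) (tour c) + dot a (zpoint R n).
Proof. by move=> hc; rewrite {1}(LprojE a) dotDl dot_dsum_tour// dot_z_proj. Qed.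

Lemma GTSP_polar_tour a c : GTSP_polar R n a -> hamilton_cycle c -> 1 <= dot a (tour c).
Proof. by move=> /GTSP_polarP Pa /(hamilton_good hn2); exact: Pa. Qed.

(** The value at [zpoint] is the average over the tours, each at least 1; if it were at most 1, all
    tours would have value 1, which tight triangles forbid. *)
Lemma GTSP_domain_dot_z a : GTSP_domain a -> 1 < dot a (zpoint R n).
Proof.
move=> Aa; have [ma ta] := GTSP_domain_TT Aa; have [Pa _ _] := Aa.
rewrite ltNge; apply/negP => z1; apply: (@tour_const_not_tight a) => // c hc.
have [s ->] := hamilton_permP hn hc.
have : \sum_(s : {perm 'I_n}) (dot a (tour (ptour s)) - dot a (zpoint R n)) = 0.
  rewrite -[RHS](sum_tours hn (Lproj_Lspace hn a)); apply: eq_bigr => t _.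
  by rewrite dot_tour_proj ?addrK//; exact: hamilton_ptour.
have ge1 t : 1 <= dot a (tour (ptour t)).
  by apply: GTSP_polar_tour => //; exact: hamilton_ptour.
move=> /eqP; rewrite psumr_eq0 => [/allP/(_ s (mem_index_enum _))|t _]; last first.
  by rewrite subr_ge0 (le_trans z1).
rewrite /= subr_eq0 => /eqP tz; apply/eqP; rewrite eq_le ge1 andbT.
by rewrite tz.
Qed.

Lemma GTSP_domain_polar_map a : GTSP_domain a -> STSP_domain (polar_map a).
Proof.
move=> Aa; have [Pa sa ba] := Aa; have z1 := GTSP_domain_dot_z Aa; have [ma _] := GTSP_domain_TT Aa.
have s0 : 0 < dot a (zpoint R n) - 1 by rewrite subr_gt0.
have pt c : hamilton_cycle c -> dot (polar_map a) (tour c) =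
    (dot a (tour c) - dot a (zpoint R n)) / (dot a (zpoint R n) - 1).
  by move=> hc; rewrite dotZl [in RHS]dot_tour_proj// addrK mulrC.
split=> [u|c hc|e].
- by rewrite dotZr Lproj_Lspace// mulr0.
- rewrite pt// ler_pdivlMr//; have := GTSP_polar_tour Pa hc; lra.
have [m [gm tm me]] := sa e; have [c [hc ec cm]] := tour_through hn2 ma gm me.
exists c; split=> //; rewrite pt//.
have -> : dot a (tour c) = 1.
  by apply/eqP; rewrite eq_le GTSP_polar_tour// andbT -tm.
by rewrite -opprB mulNr divff// gt_eqF.
Qed.

Lemma polar_inv_polar_map a : GTSP_domain a -> polar_inv (polar_map a) = a.
Proof.
move=> Aa; have z1 := GTSP_domain_dot_z Aa; set s := dot a (zpoint R n) - 1.
have s0 : 0 < s by rewrite subr_gt0.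
have aE : s^-1 *: a = polar_map a + dsum (fun u => s^-1 * pcoef a u).
  by rewrite {1}(LprojE a) scalerDr -dsumZ.
have /TT_mu muE : TT (polar_map a + dsum (fun u => s^-1 * pcoef a u)).
  by rewrite -aE; apply: TT_scale (GTSP_domain_TT Aa); rewrite invr_gt0.
rewrite /polar_inv (dsumE muE) -aE (eq_bigr _ (fun u _ => muE u)) -mulr_sumr -dot_z_proj.
have -> : s^-1 * dot a (zpoint R n) - 1 = s^-1.
  by rewrite /s; field; rewrite gt_eqF.
by rewrite invrK scalerA divff ?scale1r// gt_eqF.
Qed.

(** The number is the value of the nonnegative vector [b + dsum (mu b)] on tight tours. If it were
    0, that vector would vanish on every edge, so [b], lying in [Lspace] and in the span of the
    [delta u], would be 0 and not -1 on a tour. *)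
Lemma STSP_domain_beta b : STSP_domain b -> 0 < \sum_u mu b u - 1.
Proof.
move=> [Lb vb tb]; have [mb _] := TT_add_mu b.
set c := b + dsum (mu b) in mb.
have c0 e : 0 <= coord c e.
  by have [u [v [_ eE]]] := edge_ends e; rewrite -(ev_edge _ eE) metric_ge0.
have ct p : hamilton_cycle p -> dot b (tour p) = -1 ->
    dot c (tour p) = \sum_u mu b u - 1.
  by move=> hp bp; rewrite dotDl bp dot_dsum_tour// addrC.
have sum0 p : 0 <= dot c (tour p).
  by rewrite tourE dot_mvec sumr_ge0// => e _; rewrite mulr_ge0.
rewrite lt_def; apply/andP; split; last first.
  have [e _] := good_edge hn1 (hamilton_good hn2 (@hamilton_enum n)).
  by have [p [hp _ bp]] := tb e; rewrite -(ct p).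
apply/eqP => be0.
have c00 : c = 0.
  apply: coord_ext => e; have [p [hp ep bp]] := tb e.
  have := ct p hp bp; rewrite be0 tourE dot_mvec => /eqP.
  rewrite psumr_eq0 => [/allP/(_ e (mem_index_enum _))|f _]; last by rewrite mulr_ge0.
  by rewrite /= ep mulr1 => /eqP ->; rewrite /coord mxE.
have bE : b = dsum (fun u => -1 * mu b u).
  by rewrite dsumZ scaleN1r; apply/eqP; rewrite -subr_eq0 opprK; apply/eqP.
have b0 : b = 0 by rewrite bE; apply: Lspace_dsum_eq0; rewrite -bE.
have [e _] := good_edge hn1 (hamilton_good hn2 (@hamilton_enum n)).
by have [p [_ _]] := tb e; rewrite b0 dot0l; lra.
Qed.

Lemma polar_map_polar_inv b : STSP_domain b -> polar_map (polar_inv b) = b.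
Proof.
move=> Bb; have b0 := STSP_domain_beta Bb; have [Lb _ _] := Bb.
have bn0 : \sum_u mu b u - 1 != 0 by rewrite gt_eqF.
rewrite /polar_map /polar_inv; set s := \sum_u mu b u - 1 in b0 bn0 *.
have -> : Lproj (s^-1 *: (b + dsum (mu b))) = s^-1 *: b.
  rewrite scalerDr -dsumZ Lproj_add_dsum// => u.
  by rewrite dotZr Lb mulr0.
rewrite dotZl dotDl Lspace_z// add0r dot_dsum_z//.
have -> : \sum_u mu b u = s + 1 by rewrite subrK.
have -> : s^-1 * (s + 1) - 1 = s^-1 by field.
by rewrite invrK scalerA divff ?scale1r.
Qed.

Lemma dot_polar_inv b x : STSP_domain b -> dot (b + dsum (mu b)) x =
  (\sum_u mu b u - 1) * dot (polar_inv b) x.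
Proof. by move=> /STSP_domain_beta b0; rewrite dotZl mulrA divff ?mul1r// gt_eqF. Qed.

Lemma polar_inv_tour b c : STSP_domain b -> hamilton_cycle c -> dot b (tour c) = -1 ->
  dot (polar_inv b) (tour c) = 1.
Proof.
move=> Bb hc bc; have b0 := STSP_domain_beta Bb.
rewrite dotZl dotDl bc dot_dsum_tour// [-1 + _]addrC mulVf// gt_eqF//.
Qed.

Lemma STSP_domain_polar_inv b : STSP_domain b -> GTSP_domain (polar_inv b).
Proof.
move=> Bb; have b0 := STSP_domain_beta Bb; have [Lb vb tb] := Bb.
have [mb ttb] := TT_add_mu b.
have mg : metric (polar_inv b).
  by apply: (TT_scale _ (TT_add_mu b)).1; rewrite invr_gt0.
split=> [|e|u].
- apply/GTSP_polarP => m gm; have [e me] := good_edge hn1 gm.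
  have [c [hc _ cm]] := tour_through hn2 mg gm me.
  apply: le_trans cm; rewrite dotZl dotDl dot_dsum_tour// mulrC ler_pdivlMr// mul1r.
  by have := vb c hc; lra.
- have [c [hc ec bc]] := tb e; exists (fun f => f \in cycle_edges c).
  by split; [exact: hamilton_good|exact: polar_inv_tour|rewrite ec].
(* A tight tour through the far side of a tight triangle stays tight when rerouted through [u],
   where it then has degree 4. *)
have [p tp pE] := ttb u; have /and3P[u1 u2 p12] := tp.
have [e eE] := edge_of p12; have [c [hc ec bc]] := tb e.
have me : (0 < (e \in cycle_edges c))%N by rewrite ec.
have [m [gm mE]] := dot_detour_triangle u (hamilton_good hn2 hc) me eE.
exists m; split=> //.
  rewrite mE -tourE polar_inv_tour// !evZ pE; lra.
(* The degree at [u] is read off by evaluating the detour identity at [delta u]. *)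
have := mE (delta R u); rewrite dot_delta_mvec -tourE dot_delta_tour//.
rewrite !ev_delta// !eqxx /= (negbTE u1) (negbTE u2) /= => h.
by rewrite -(ltr_nat R); lra.
Qed.

End TightTriangles.

(** * The carriers of the two deletions *)

Section Carriers.
Context {R : realType} {n : nat}.
Hypothesis hn : (5 <= n)%N.
Implicit Types (e : edge n) (u v w : 'I_n) (a b q : edge_space R n)
  (nu : 'I_n -> R) (c : seq 'I_n) (m : edge n -> nat).

Let hn2 : (2 < n)%N. Proof. exact: leq_trans hn. Qed.
Let hn1 : (1 < n)%N. Proof. exact: leq_trans hn. Qed.

Definition tight_face a : set (edge_space R n) := min_face pnormal prhs a.

Lemma face_tight_face a : GTSP_polar R n a -> face (GTSP_polar R n) (tight_face a).
Proof. by rewrite hpoly_GTSP_polar// => Pa; exact: face_min_face. Qed.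

Lemma tight_faceP a a' : GTSP_polar R n a -> supported a ->
  tight_face a a' <-> GTSP_polar R n a' /\ tight_le a a'.
Proof.
move=> Pa sa; split=> [[Qa' ta']|[Pa' ta']].
  have Pa' : GTSP_polar R n a' by rewrite hpoly_GTSP_polar.
  by split=> //; exact: tsub_tight_le.
split; first by rewrite -hpoly_GTSP_polar.
have [e _] := good_edge hn1 (hamilton_good hn2 (@hamilton_enum n)).
by have [m [gm tm _]] := sa e; exact: tight_le_tsub tm ta'.
Qed.

Lemma tight_face_refl a : GTSP_polar R n a -> tight_face a a.
Proof. by rewrite hpoly_GTSP_polar// => Qa; split. Qed.

Lemma face_tight_face_sub F a a' : face (GTSP_polar R n) F -> F a -> tight_face a a' -> F a'.
Proof.
rewrite hpoly_GTSP_polar// => fF Fa [Qa' ta'].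
exact: (face_tsub fF Fa Qa' ta').
Qed.

Lemma bounded_face_supported F a : face (GTSP_polar R n) F -> bounded_set F ->
  F a -> supported a.
Proof.
move=> fF bF Fa e; have Pa : GTSP_polar R n a by case: fF Fa => ? [? [_ ->]] [].
apply: contrapT => ne.
have [[m [gm tm]]|nt] := pselect (exists m, good m /\ dot a (mvec m) = 1).
  (* Otherwise two copies of [e] could be added to a tight multigraph for free. *)
  have ae : coord a e != 0.
    apply/eqP => ae; apply: ne; exists (fun f => m f + (f == e) * 1.*2)%N.
    by split; [exact: good_addn2|rewrite dot_addn2 ae mul0r addr0|rewrite eqxx addnC].
  have : mvec (fun f => f == e) = 0 :> edge_space R n.
    apply: (bounded_ray (x := a) bF) => t t0.
    apply: face_tight_face_sub fF Fa _; split.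
      rewrite -hpoly_GTSP_polar//; apply/GTSP_polarP => m' gm'.
      have /GTSP_polarP/(_ _ gm') := Pa; rewrite dotDl dotZl dotC (dotC (mvec _)) => h.
      rewrite -[leLHS]addr0; apply: lerD => //.
      by rewrite mulr_ge0// dotC dot_mvec1 coord_mvec.
    case=> [f|[r /asboolP gr]] /=; rewrite dotDr dotZr (dotC _ a) dot_mvec1.
      move=> af; rewrite af add0r dot_mvec1 coord_mvec; case: eqP => [fe|]; last by rewrite mulr0.
      by rewrite fe af eqxx in ae.
    move=> tr; rewrite tr coord_mvec.
    have -> : (r e : nat) = 0%N; last by rewrite mulr0 addr0.
    apply/eqP; rewrite -leqn0 leqNgt; apply/negP => re; apply: ne.
    by exists (fun f => r f : nat).
  move=> /(congr1 (fun x => coord x e)); rewrite coord_mvec eqxx /coord mxE => /eqP.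
  by rewrite oner_eq0.
(* Without tight multigraphs only nonnegativity can be tight, so the face contains the ray from [a]
   in its own direction. *)
have a0 : a = 0.
  apply: (bounded_ray (x := a) bF) => t t0; apply: face_tight_face_sub fF Fa _.
  rewrite -[X in X + _]scale1r -scalerDl; split.
    rewrite -hpoly_GTSP_polar//; apply/GTSP_polarP => m gm; rewrite dotZl.
    have /GTSP_polarP/(_ _ gm) h := Pa.
    by apply: (le_trans h); rewrite ler_peMl ?lerDl// (le_trans _ h).
  case=> [f|[r /asboolP gr]] /=; rewrite dotZr; first by move=> ->; rewrite mulr0.
  by rewrite dotC => tr; case: nt; exists (fun f => r f : nat).
have /GTSP_polarP/(_ _ (hamilton_good hn2 (@hamilton_enum n))) := Pa.
by rewrite a0 dot0l ler10.
Qed.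

Lemma deletion_GTSP_domain F a : GTSP_deletion R n F -> F a -> GTSP_domain a.
Proof.
move=> [[fF bF] F0] Fa; have sa := bounded_face_supported fF bF Fa.
have Pa : GTSP_polar R n a by case: fF Fa => ? [? [_ ->]] [].
split=> // u; apply: contrapT => nb.
have : (F `&` STSP_diamond R n) (delta R u); last by rewrite F0.
have Pd : GTSP_polar R n (delta R u).
  apply/GTSP_polarP => m gm; rewrite dot_delta_mvec.
  by have := good_deg_ge2 u hn1 gm; rewrite -(ler_nat R) => h; lra.
split; last by split=> //; apply/STSP_const => c hc; exact: dot_delta_tour.
apply: face_tight_face_sub fF Fa _; apply/tight_faceP => //; split=> // m gm tm.
rewrite dot_delta_mvec; have := good_deg_ge2 u hn1 gm.
rewrite leq_eqVlt => /orP[/eqP <-|dm]; first by rewrite divff.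
by case: nb; exists m.
Qed.

Lemma tight_face_deletion a : GTSP_domain a -> GTSP_deletion R n (tight_face a).
Proof.
move=> Aa; have [Pa sa _] := Aa; have [_ ta] := GTSP_domain_TT hn Aa.
split; first split; first exact: face_tight_face.
  (* A coordinate of [y] is at most the value 1 of [y] on a tight multigraph using that edge. *)
  exists 1; split=> [|M M1 y /= /(tight_faceP y Pa sa)[Py ay]]; first exact: num_real.
  apply: le_trans (ltW M1); apply: norm_le_coord => // i; have [m [gm tm me]] := sa (enum_val i).
  have := ay _ gm tm; rewrite dot_mvec (bigD1 (enum_val i))//=.
  have ye : coord y (enum_val i) = y ord0 i by rewrite /coord enum_valK.
  have y0 : 0 <= y ord0 i by rewrite -ye; exact: GTSP_polar_ge0.
  rewrite ye ger0_norm// => <-; apply: ler_wpDr.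
    by apply: sumr_ge0 => f _; rewrite mulr_ge0// GTSP_polar_ge0.
  by rewrite ler_peMr// ler1n.
(* A common point would inherit the tight triangles of [a] and yet be 1 on all tours. *)
apply/seteqP; split=> // y [/(tight_faceP y Pa sa)[Py ay] [_ /STSP_const y1]].
by apply: (tour_const_not_tight hn y1) => u; exact: tight_at_tight_le sa ay (ta u).
Qed.

Lemma carrier_GTSP_deletion a : carrier (GTSP_deletion R n) a <-> GTSP_domain a.
Proof.
split=> [[F dF Fa]|Aa]; first exact: deletion_GTSP_domain dF Fa.
exists (tight_face a); first exact: tight_face_deletion.
by apply: tight_face_refl; case: Aa.
Qed.

Lemma STSP_polarP b : STSP_polar R n b <->
  Lspace R n b /\ forall c, hamilton_cycle c -> -1 <= dot b (tour c).
Proof.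
have E x : Lspace R n b -> (dot (- b) (x - zpoint R n) <= 1) = (-1 <= dot b x).
  by move=> Lb; rewrite dotNl dotBr (Lspace_z Lb) subr0 lerNl.
split=> [[Lb h]|[Lb h]]; split=> //.
  by apply/STSP_valid => x Sx; rewrite -E// h.
by move=> x Sx; rewrite E//; move: x Sx; apply/STSP_valid.
Qed.

(** The boolean is a sign: each equation of [Lspace] is split into two inequalities. *)
Definition sidx : finType := ('I_n * bool + {perm 'I_n})%type.

Definition snormal (i : sidx) : edge_space R n :=
  match i with
  | inl us => (-1) ^+ us.2 *: delta R us.1
  | inr s => tour (ptour s)
  end.

Definition srhs (i : sidx) : R := if i is inr _ then -1 else 0.

Lemma hpoly_STSP_polar : STSP_polar R n = hpoly snormal srhs.
Proof.
apply/seteqP; split=> b.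
  move=> /STSP_polarP[Lb vb] [[u s]|s] /=; first by rewrite dotZl Lb mulr0.
  by rewrite dotC; apply: vb; exact: hamilton_ptour.
move=> h; apply/STSP_polarP; split=> [u|c hc].
  have := h (inl (u, false)); have := h (inl (u, true)).
  by rewrite /= expr0 expr1 scale1r scaleN1r dotNl; lra.
by have [s ->] := hamilton_permP hn hc; have := h (inr s); rewrite /= dotC.
Qed.

(* The projection of the unit vector of [e], divided by [zpoint]'s coordinate
   [2 / (n - 1)] to give the right-hand side [-1]. *)
Definition nonneg_vertex e : edge_space R n :=
  ((n%:R - 1) / 2) *: Lproj (mvec (fun f => f == e)).

Lemma dot_nonneg_vertex e c : hamilton_cycle c -> dot (nonneg_vertex e) (tour c) =
  (n%:R - 1) / 2 * (e \in cycle_edges c)%:R - 1.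
Proof.
move=> hc; have n1 : n%:R - 1 != 0 :> R by rewrite gt_eqF// n1_gt0.
have := dot_tour_proj hn (mvec (fun f => f == e) : edge_space R n) hc.
rewrite ![dot (mvec _) _]dotC !dot_mvec1 tourE coord_mvec {1}/coord mxE dotZl => ->.
by field.
Qed.

Lemma nonneg_vertex_polar e : STSP_polar R n (nonneg_vertex e).
Proof.
apply/STSP_polarP; split=> [u|c hc]; first by rewrite dotZr Lproj_Lspace// mulr0.
rewrite dot_nonneg_vertex// lerBrDl addrN mulr_ge0// divr_ge0//.
by rewrite ltW// n1_gt0.
Qed.

(** The difference vanishes on all tours avoiding [e], so by [const_avoiding] it is a multiple of
    the unit vector of [e] modulo the [delta u]. Projection makes it a multiple of
    [nonneg_vertex e], which is -1 on a tour avoiding [e]; the multiple is 0. *)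
Lemma nonneg_vertex_unique e b : Lspace R n b ->
  (forall c, hamilton_cycle c -> e \notin cycle_edges c -> dot b (tour c) = -1) ->
  b = nonneg_vertex e.
Proof.
move=> Lb h; pose d := b - nonneg_vertex e.
have Ld : Lspace R n d.
  by move=> u; rewrite dotBr Lb; have /STSP_polarP[-> _] := nonneg_vertex_polar e; rewrite subrr.
have d0 c : hamilton_cycle c -> e \notin cycle_edges c -> dot d (tour c) = 0.
  by move=> hc ec; rewrite dotBl h// dot_nonneg_vertex// (negbTE ec) mulr0; lra.
have [nu nuE] := const_avoiding hn d0.
pose k := coord d e - coord (dsum nu) e.
have dE : d = k *: mvec (fun f => f == e) + dsum nu.
  apply: coord_ext => f; rewrite [RHS]coordD coordZ coord_mvec.
  case: (eqVneq f e) => [->|fe]; first by rewrite mulr1 /k; lra.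
  rewrite mulr0 add0r; have [u [v [uv fE]]] := edge_ends f.
  rewrite -!(ev_edge _ fE) ev_dsum// nuE// -fE.
  by apply: contra_neq fe => ?; exact: val_inj.
have dP : d = (k * (2 / (n%:R - 1))) *: nonneg_vertex e.
  have n1 : n%:R - 1 != 0 :> R by rewrite gt_eqF// n1_gt0.
  have -> : (k * (2 / (n%:R - 1))) *: nonneg_vertex e = k *: Lproj (mvec (fun f => f == e)).
    by rewrite scalerA; congr (_ *: _); field.
  rewrite -[LHS](Lproj_add_dsum hn (fun=> 0) Ld).
  have -> : d + dsum (fun=> 0) = k *: Lproj (mvec (fun f => f == e)) +
      dsum (fun u => nu u + k * pcoef (mvec (fun f => f == e)) u).
    rewrite (_ : dsum (fun=> 0) = 0) ?addr0; last by rewrite /dsum big1// => u _; rewrite scale0r.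
    by rewrite dsumD dsumZ addrCA -scalerDr -LprojE addrC.
  by apply: Lproj_add_dsum => // u; rewrite dotZr Lproj_Lspace// mulr0.
have [c [hc ec]] := tour_avoiding hn e.
have := d0 c hc ec; rewrite dP dotZl dot_nonneg_vertex// (negbTE ec) mulr0 sub0r mulrN1.
move=> /eqP; rewrite oppr_eq0 => /eqP k0.
by apply/eqP; rewrite -subr_eq0 -/d dP k0 scale0r.
Qed.

Lemma nonneg_vertex_vertices e : nonneg_vertices R n (nonneg_vertex e).
Proof.
have Pe := nonneg_vertex_polar e; split.
  rewrite /vertex (_ : [set _] = min_face snormal srhs (nonneg_vertex e)).
    by rewrite hpoly_STSP_polar; apply: face_min_face; rewrite -hpoly_STSP_polar.
  apply/seteqP; split=> [b ->|b [Qb tb]] /=.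
    by split=> //; rewrite -hpoly_STSP_polar.
  have /STSP_polarP[Lb _] : STSP_polar R n b by rewrite hpoly_STSP_polar.
  apply: nonneg_vertex_unique => // c hc ec; have [s cE] := hamilton_permP hn hc.
  have := tb (inr s); rewrite /= -cE !(dotC (tour c)); apply.
  by rewrite dot_nonneg_vertex// (negbTE ec) mulr0 sub0r.
exists e; have /STSP_polarP[Le _] := Pe; rewrite (Lspace_z Le) sub0r.
have n1 := n1_gt0 (R := R) hn.
have E x : STSP R n x -> dot (nonneg_vertex e) x = (n%:R - 1) / 2 * coord x e - 1.
  move=> Sx.
  suff : dot (nonneg_vertex e - ((n%:R - 1) / 2) *: mvec (fun f => f == e)) x = -1.
    by rewrite dotBl [X in _ - X]dotZl (dotC (mvec _)) dot_mvec1; lra.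
  move: x Sx; apply/STSP_const => c hc.
  rewrite dotBl [X in _ - X]dotZl (dotC (mvec _)) dot_mvec1 dot_nonneg_vertex//.
  by rewrite [X in coord X]tourE coord_mvec; lra.
apply/seteqP; split=> x /= [Sx h]; split=> //; last by rewrite E// h; lra.
move: h; rewrite E// => h; have : (n%:R - 1) / 2 * coord x e = 0 by lra.
by move=> /eqP; rewrite mulf_eq0 gt_eqF ?divr_gt0// => /eqP.
Qed.

(** If all tight tours of [b] avoid [e], they are tight at [nonneg_vertex e], which then lies in
    every face containing [b]. Conversely, a nonnegativity vertex in the smallest face of [b] would
    force a tight tour through [e] to miss [e]. *)
Lemma carrier_STSP_deletion b : carrier (STSP_deletion R n) b <-> STSP_domain b.
Proof.
split=> [[F [fF F0] Fb]|[Lb vb tb]].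
  have Pb : STSP_polar R n b by case: fF Fb => ? [? [_ ->]] [].
  have [Lb vb] := (STSP_polarP b).1 Pb; split=> // e; apply: contrapT => ne.
  have : (F `&` nonneg_vertices R n) (nonneg_vertex e); last by rewrite F0.
  split; last exact: nonneg_vertex_vertices.
  have Pe := nonneg_vertex_polar e; move: fF Pe; rewrite hpoly_STSP_polar => fF Pe.
  apply: face_tsub fF Fb Pe _ => -[[u s]|s] /=.
    by rewrite !dotZl; have := nonneg_vertex_polar e => /STSP_polarP[-> _]; rewrite mulr0.
  rewrite !(dotC (tour _)) => ts; have hs := hamilton_ptour s.
  rewrite dot_nonneg_vertex//; have [ec|_] := boolP (e \in _); last by rewrite mulr0 sub0r.
  by case: ne; exists (ptour s).
have Pb : STSP_polar R n b by apply/STSP_polarP.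
exists (min_face snormal srhs b); last by split=> //; rewrite -hpoly_STSP_polar.
split; first by rewrite /= hpoly_STSP_polar; apply: face_min_face; rewrite -hpoly_STSP_polar.
apply/seteqP; split=> // y [[Qy ty] [_ [e yE]]].
have /STSP_polarP[Ly _] : STSP_polar R n y by rewrite hpoly_STSP_polar.
have [c [hc ec bc]] := tb e; have [s cE] := hamilton_permP hn hc.
have yc : dot y (tour c) = -1.
  by have := ty (inr s); rewrite /= -cE !(dotC (tour c)); apply.
have : [set x | STSP R n x /\ dot y x = dot y (zpoint R n) - 1] (tour c).
  by split; [exact: STSP_tour|rewrite (Lspace_z Ly) sub0r].
rewrite yE => -[_]; rewrite tourE coord_mvec ec => /eqP.
by rewrite oner_eq0.
Qed.

End Carriers.

(** * The rotation complex *)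

Lemma linear_rV_continuous {R : realType} {d : nat} {W : normedModType R}
    (f : 'rV[R]_d -> W) : (forall k x y, f (k *: x + y) = k *: f x + f y) ->
  continuous f.
Proof.
move=> lf; have f0 : f 0 = 0.
  by have := lf (-1) 0 0; rewrite scaler0 addr0 scaleN1r addNr.
have fE : f = fun x => \sum_i x ord0 i *: f (delta_mx 0 i).
  apply/funext => x; rewrite [in LHS](row_sum_delta x).
  by elim/big_rec2: _ => [//|j y1 y2 _ <-]; rewrite lf.
rewrite fE; apply: continuous_big => [|i _ x]; first exact: add_continuous.
apply: (@cvgZr_tmp _ _ _ (nbhs (x : 'rV[R]_d)) _ (fun y : 'rV[R]_d => y ord0 i)).
exact: coord_continuous.
Qed.

Lemma continuous_bigmax {R : realType} {T : topologicalType} (I : Type) (s : seq I)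
    (P : pred I) (h : T -> R) (F : I -> T -> R) : continuous h ->
  (forall i, continuous (F i)) ->
  continuous (fun x => \big[Num.max/h x]_(i <- s | P i) F i x).
Proof.
move=> ch cF; elim: s => [|i s IH].
  by rewrite (_ : (fun x => _) = h)//; apply/funext => x; rewrite big_nil.
have [Pi|Pi] := boolP (P i); last first.
  rewrite (_ : (fun x => _) = fun x => \big[Num.max/h x]_(i <- s | P i) F i x)//.
  by apply/funext => x; rewrite big_cons (negbTE Pi).
rewrite (_ : (fun x => _) =
  F i \max (fun x => \big[Num.max/h x]_(i <- s | P i) F i x)); last first.
  by apply/funext => x; rewrite big_cons Pi.
by move=> x; apply: continuous_max; [exact: cF|exact: IH].
Qed.

Lemma line_continuous {R : realType} {V : normedModType R} (x v : V) :
  continuous (fun t : R => x + t *: v).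
Proof.
move=> t; apply: cvgD; first exact: cvg_cst.
by apply: cvgZr_tmp; exact: cvg_id.
Qed.

Section Rotation.
Context {R : realType} {n : nat}.
Hypothesis hn : (5 <= n)%N.
Implicit Types (e : edge n) (u v w : 'I_n) (a b q : edge_space R n)
  (nu : 'I_n -> R) (c : seq 'I_n) (m : edge n -> nat).

Let hn2 : (2 < n)%N. Proof. exact: leq_trans hn. Qed.
Let hn1 : (1 < n)%N. Proof. exact: leq_trans hn. Qed.

Definition tight_set a : set (edge_space R n) := [set x | GTSP R n x /\ dot a x = 1].

Lemma tight_setS a a' : GTSP_polar R n a -> tight_set a `<=` tight_set a' <-> tight_le a a'.
Proof.
move=> Pa; split=> [h m gm tm|h x [Gx tx]].
  by have [] := h (mvec m) (conj (GTSP_mvec gm) tm).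
by split=> //; apply: GTSP_tight Gx tx.
Qed.

Lemma delta_GTSP u : valid (delta R u) 1 (GTSP R n).
Proof.
apply/GTSP_valid => m gm; rewrite dot_delta_mvec.
by have := good_deg_ge2 u hn1 gm; rewrite -(ler_nat R) => h; lra.
Qed.

(** [nu] is the excess of the coefficients of [q] over [mu b]; the face depends only on where it is
    positive. *)
Definition subtight b nu : set (edge_space R n) :=
  [set x | tight_set (polar_inv b) x /\ forall u, 0 < nu u -> dot (delta R u) x = 1].

Lemma rotation_dot b nu x : STSP_domain b ->
  dot (b + dsum (fun u => mu b u + nu u)) x - (dot b (zpoint R n) - 1 +
    dot (dsum (fun u => mu b u + nu u)) (zpoint R n)) =
  (\sum_u mu b u - 1) * (dot (polar_inv b) x - 1) + \sum_u nu u * (dot (delta R u) x - 1).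
Proof.
move=> Bb; have [Lb _ _] := Bb; rewrite (Lspace_z Lb) dot_dsum_z// dsumD addrA dotDl.
rewrite dot_polar_inv// dot_dsum big_split /=.
under [X in _ = _ + X]eq_bigr do rewrite mulrBr mulr1.
by rewrite sumrB; lra.
Qed.

Lemma rotation_facesP b F : STSP_domain b ->
  rotation_faces b F <-> exists2 nu, (forall u, 0 <= nu u) & F = subtight b nu.
Proof.
move=> Bb; have b0 := STSP_domain_beta hn Bb; have [Pg sg _] := STSP_domain_polar_inv hn Bb.
have zero nu x : (forall u, 0 <= nu u) -> GTSP R n x ->
    dot (b + dsum (fun u => mu b u + nu u)) x = dot b (zpoint R n) - 1 +
    dot (dsum (fun u => mu b u + nu u)) (zpoint R n) <->
    dot (polar_inv b) x = 1 /\ forall u, 0 < nu u -> dot (delta R u) x = 1.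
  move=> nu0 Gx; have gx : 0 <= dot (polar_inv b) x - 1 by rewrite subr_ge0 Pg.
  have dx u : 0 <= nu u * (dot (delta R u) x - 1).
    by rewrite mulr_ge0// subr_ge0; exact: delta_GTSP.
  have := rotation_dot nu x Bb; split=> [tx|[tx ux]].
    have /eqP : (\sum_u mu b u - 1) * (dot (polar_inv b) x - 1) +
        \sum_u nu u * (dot (delta R u) x - 1) = 0 by rewrite -H tx subrr.
    rewrite paddr_eq0; [|by rewrite mulr_ge0// ltW|by apply: sumr_ge0].
    rewrite mulf_eq0 gt_eqF//= subr_eq0 => /andP[/eqP -> ].
    rewrite psumr_eq0 => [/allP h|u _]; last exact: dx.
    split=> // u u0; have := h u (mem_index_enum _).
    by rewrite /= mulf_eq0 gt_eqF//= subr_eq0 => /eqP.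
  apply/eqP; rewrite -subr_eq0 H tx subrr mulr0 add0r; apply/eqP; apply: big1 => u _.
  have := nu0 u; rewrite le_eqVlt => /orP[/eqP <-|/ux ->]; first by rewrite mul0r.
  by rewrite subrr mulr0.
have eqset nu : (forall u, 0 <= nu u) -> [set x | GTSP R n x /\
    dot (b + dsum (fun u => mu b u + nu u)) x = dot b (zpoint R n) - 1 +
    dot (dsum (fun u => mu b u + nu u)) (zpoint R n)] = subtight b nu.
  move=> nu0; apply/seteqP; split=> x.
    by move=> [Gx /(zero _ _ nu0 Gx)[tx ux]]; split.
  by move=> [[Gx tx] ux]; split=> //; apply/zero.
split=> [[fF [q [Lq vq FE]]]|[nu nu0 ->]].
  have [mq qE] := (LperpP hn q).1 Lq.
  pose nu u := mq u - mu b u.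
  have {}qE : q = dsum (fun u => mu b u + nu u).
    by rewrite qE; apply: dsumE => u; rewrite /nu addrC subrK.
  rewrite qE in vq FE.
  (* Validity is tested at a tight tour rerouted through [u] along a triangle attaining [mu b u];
     the slack there is exactly [nu u]. *)
  have nu0 u : 0 <= nu u.
    have [p tp muE] := mu_attained hn b u; have /and3P[_ _ p12] := tp.
    have [Lb _ tb] := Bb; have [e eE] := edge_of p12; have [c [hc ec bc]] := tb e.
    have me : (0 < (e \in cycle_edges c))%N by rewrite ec.
    have [m [gm mE]] := dot_detour_triangle (R := R) u (hamilton_good hn2 hc) me eE.
    have := vq _ (GTSP_mvec gm); rewrite mE -tourE dotDl bc (Lspace_z Lb).
    rewrite dot_dsum_tour// dot_dsum_z//.
    by have := triangle_add_dsum b (fun u => mu b u + nu u) tp; rewrite muE; lra.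
  by exists nu; rewrite // FE eqset.
have vq : valid (b + dsum (fun u => mu b u + nu u)) (dot b (zpoint R n) - 1 +
    dot (dsum (fun u => mu b u + nu u)) (zpoint R n)) (GTSP R n).
  move=> x Gx; rewrite -subr_ge0 rotation_dot// addr_ge0//.
    by apply: mulr_ge0; [exact: ltW|rewrite subr_ge0 Pg].
  by apply: sumr_ge0 => u _; rewrite mulr_ge0// subr_ge0; exact: delta_GTSP.
split.
  rewrite -eqset//; eexists; eexists; split; first exact: vq.
  by [].
exists (dsum (fun u => mu b u + nu u)); split=> //; last by rewrite eqset.
by apply/LperpP => //; exists (fun u => mu b u + nu u).
Qed.

Lemma subtight0 b : subtight b (fun=> 0) = tight_set (polar_inv b).
Proof. by apply/seteqP; split=> x => [[]//|tx]; split=> // u; rewrite ltxx. Qed.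

Lemma rotation_faces_eq b b' : STSP_domain b -> STSP_domain b' ->
  rotation_faces b = rotation_faces b' <-> tight_set (polar_inv b) = tight_set (polar_inv b').
Proof.
have half b1 b2 : STSP_domain b1 -> STSP_domain b2 -> rotation_faces b1 = rotation_faces b2 ->
    tight_set (polar_inv b1) `<=` tight_set (polar_inv b2).
  move=> B1 B2 E; have : rotation_faces b1 (tight_set (polar_inv b1)).
    by apply/rotation_facesP => //; exists (fun=> 0); rewrite ?subtight0.
  by rewrite E => /(rotation_facesP _ B2)[nu _ ->] x [].
move=> Bb Bb'; split=> [E|E]; first by apply/seteqP; split; apply: half.
apply/seteqP; split=> F.
  move=> /(rotation_facesP _ Bb)[nu nu0 ->]; apply/rotation_facesP => //.
  by exists nu => //; rewrite /subtight E.
move=> /(rotation_facesP _ Bb')[nu nu0 ->]; apply/rotation_facesP => //.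
by exists nu => //; rewrite /subtight E.
Qed.

Lemma rotation_cellP b b' : STSP_domain b -> rotation_cell b b' <->
  STSP_domain b' /\ tight_set (polar_inv b') = tight_set (polar_inv b).
Proof.
move=> Bb; split=> [[/(carrier_STSP_deletion hn) Bb' E]|[Bb' E]].
  by split=> //; apply/rotation_faces_eq.
by split; [exact/carrier_STSP_deletion|exact/rotation_faces_eq].
Qed.

Lemma GTSP_domain_tight a a' : GTSP_polar R n a' -> GTSP_domain a ->
  tight_le a a' -> tight_le a' a -> GTSP_domain a'.
Proof.
move=> Pa' [Pa sa ba] aa' a'a; split=> // [e|u].
  by have [m [gm tm me]] := sa e; exists m; split=> //; exact: aa'.
by have [m [gm tm me]] := ba u; exists m; split=> //; exact: aa'.
Qed.

Lemma dsum_linear (k : R) nu nu' :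
  dsum (fun u => k * nu u + nu' u) = k *: dsum nu + dsum nu' :> edge_space R n.
Proof. by rewrite dsumD dsumZ. Qed.

Lemma Lproj_linear (k : R) a b : Lproj (k *: a + b) = k *: Lproj a + Lproj b.
Proof.
rewrite /Lproj (_ : pcoef (k *: a + b) = fun u => k * pcoef a u + pcoef b u).
  by rewrite dsum_linear scalerBr opprD addrACA.
apply/funext => u; rewrite /pcoef.
under [X in 2 * X]eq_bigr do rewrite dotDr dotZr.
rewrite big_split /= -mulr_sumr dotDr dotZr; ring.
Qed.

Lemma gap_linear u p (k : R) a b : gap (k *: a + b) u p = k * gap a u p + gap b u p.
Proof. by rewrite /gap !evD !evZ; ring. Qed.

Lemma gap_continuous u p : continuous (fun b => gap b u p).
Proof. exact: (linear_rV_continuous (gap_linear u p)). Qed.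

Lemma mu_continuous u : continuous (fun b => mu b u).
Proof.
apply: continuous_bigmax => [b|p]; last exact: gap_continuous.
apply: continuousN; apply: continuous_big => [|p _ x]; first exact: add_continuous.
apply: (@continuous_comp _ _ _ (fun y => gap y u p) (fun t : R => `|t|)).
  exact: gap_continuous.
exact: norm_continuous.
Qed.

Lemma polar_inv_continuous b : STSP_domain b -> {for b, continuous (@polar_inv R n)}.
Proof.
move=> Bb; have b0 := STSP_domain_beta hn Bb.
have cs : {for b, continuous (fun x => \sum_u mu x u - 1)}.
  apply: continuousB; last exact: cst_continuous.
  apply: continuous_big => [|u _]; first exact: add_continuous.
  exact: mu_continuous.
apply: continuousZ; first by apply: continuousV => //; rewrite gt_eqF.
apply: continuousD; first exact: cvg_id.
apply: continuous_big => [|u _ x]; first exact: add_continuous.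
apply: (@continuousZ _ _ _ (fun y => mu y u) (fun=> delta R u)).
  exact: mu_continuous.
exact: cst_continuous.
Qed.

Lemma polar_map_continuous a : GTSP_domain a -> {for a, continuous (@polar_map R n)}.
Proof.
move=> Aa; have z1 := GTSP_domain_dot_z hn Aa.
have cs : {for a, continuous (fun x => dot x (zpoint R n) - 1)}.
  apply: continuousB; last exact: cst_continuous.
  rewrite (_ : (fun x => _) = dot (zpoint R n)); first exact: dot_continuous.
  by apply/funext => x; rewrite dotC.
apply: continuousZ; last exact: (linear_rV_continuous Lproj_linear).
by apply: continuousV => //; rewrite subr_eq0 gt_eqF.
Qed.

(** On the segment from [y] to [a], all points except possibly [y] have the tight multigraphs of
    [a], so their images lie in the cell; let them tend to [y]. *)
Lemma tight_face_subset_closure a : GTSP_domain a ->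
  [set polar_map y | y in tight_face a] `<=` closure (rotation_cell (polar_map a)).
Proof.
move=> Aa _ [y ay <-]; have [Pa sa _] := Aa.
have Ay : GTSP_domain y by apply: (deletion_GTSP_domain hn (tight_face_deletion hn Aa) ay).
have [Py ly] := (tight_faceP hn y Pa sa).1 ay.
have Bp := GTSP_domain_polar_map hn Aa.
pose yt (t : R) := y + t *: (a - y).
have cell t : 0 < t <= 1 -> rotation_cell (polar_map a) (polar_map (yt t)).
  move=> /andP[t0 t1].
  have E m : dot (yt t) (mvec m) = (1 - t) * dot y (mvec m) + t * dot a (mvec m).
    by rewrite dotDl dotZl dotBl; lra.
  have Pt : GTSP_polar R n (yt t).
    apply/GTSP_polarP => m gm; rewrite E.
    have /GTSP_polarP/(_ _ gm) ya := Py; have /GTSP_polarP/(_ _ gm) aa := Pa.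
    have h1 : (1 - t) * 1 <= (1 - t) * dot y (mvec m) by rewrite ler_wpM2l// subr_ge0.
    have h2 : t * 1 <= t * dot a (mvec m) by rewrite ler_wpM2l// ltW.
    by lra.
  have l1 : tight_le a (yt t) by move=> m gm tm; rewrite E tm (ly _ gm tm); lra.
  have l2 : tight_le (yt t) a.
    move=> m gm; rewrite E => tm.
    have /GTSP_polarP/(_ _ gm) ya := Py; have /GTSP_polarP/(_ _ gm) aa := Pa.
    have h1 : (1 - t) * 1 <= (1 - t) * dot y (mvec m) by rewrite ler_wpM2l// subr_ge0.
    have : t * (dot a (mvec m) - 1) <= 0 by lra.
    by rewrite pmulr_rle0//; lra.
  have At := GTSP_domain_tight Pt Aa l1 l2.
  apply/(rotation_cellP _ Bp); split; first exact: (GTSP_domain_polar_map hn At).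
  by rewrite !polar_inv_polar_map//; apply/seteqP; split; apply/tight_setS.
have yt0 : yt 0 = y by rewrite /yt scale0r addr0.
have cyt : {for (0 : R), continuous yt}.
  exact: line_continuous.
have cpt : {for (0 : R), continuous (@polar_map R n \o yt)}.
  apply: continuous_comp; first exact: cyt.
  by rewrite yt0; exact: polar_map_continuous.
have pt : polar_map (yt t) @[t --> (0 : R)^'+] --> polar_map y.
  by have := cvg_at_right_filter cpt; rewrite /= yt0.
move=> U /pt nU; near (0 : R)^'+ => t.
exists (polar_map (yt t)); split; last by near: t.
apply: cell; apply/andP; split; first by near: t; exact: nbhs_right_gt.
by near: t; exact: nbhs_right_le.
Unshelve. all: by end_near.
Qed.

Lemma rotation_cell_subset a : GTSP_domain a ->
  rotation_cell (polar_map a) `<=` [set polar_map y | y in tight_face a].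
Proof.
move=> Aa b /(rotation_cellP _ (GTSP_domain_polar_map hn Aa))[Bb E].
have [Pa sa _] := Aa; have [Pg _ _] := STSP_domain_polar_inv hn Bb.
exists (polar_inv b); last exact: polar_map_polar_inv.
apply/tight_faceP => //; split=> //; apply/tight_setS => //.
by rewrite E polar_inv_polar_map.
Qed.

End Rotation.

(** * Images of faces *)

Section Images.
Context {R : realType} {n : nat}.
Hypothesis hn : (5 <= n)%N.
Implicit Types (e : edge n) (u v w : 'I_n) (a b q : edge_space R n)
  (nu : 'I_n -> R) (c : seq 'I_n) (m : edge n -> nat).

Let hn2 : (2 < n)%N. Proof. exact: leq_trans hn. Qed.
Let hn1 : (1 < n)%N. Proof. exact: leq_trans hn. Qed.

(* With one tight triangle fixed at each vertex, [mu] becomes linear on the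
   image of the face, whence a description of this image by linear
   inequalities. *)
Definition lift (t : 'I_n -> 'I_n * 'I_n) b := b + dsum (fun u => gap b u (t u)).

Definition imidx : finType := ('I_n * bool + (@pidx n + @pidx n))%type.

(** With [s] the sum of the gaps minus 1, these say that [lift t b] divided by [s] lies in the face
    of [a], multiplied by [s] to become affine in [b]. The last family reverses the inequalities
    tight at [a] and is trivial elsewhere. *)
Definition imform a (t : 'I_n -> 'I_n * 'I_n) (i : imidx) b : R :=
  match i with
  | inl us => (-1) ^+ us.2 * dot (delta R us.1) b
  | inr (inl i) => dot (pnormal i) (lift t b) - prhs i * \sum_u gap b u (t u)
  | inr (inr i) => if dot (pnormal i) a == prhs i then
      prhs i * \sum_u gap b u (t u) - dot (pnormal i) (lift t b) else 0
  end.

Definition imrhs a (i : imidx) : R :=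
  match i with
  | inl _ => 0
  | inr (inl i) => - prhs i
  | inr (inr i) => if dot (pnormal i) a == prhs i then prhs i else 0
  end.

Lemma lift_linear t (k : R) b b' : lift t (k *: b + b') = k *: lift t b + lift t b'.
Proof.
rewrite /lift (_ : dsum _ = k *: dsum (fun u => gap b u (t u)) + dsum (fun u => gap b' u (t u))).
  by rewrite scalerDr addrACA.
by rewrite -dsum_linear; apply: dsumE => u; rewrite gap_linear.
Qed.

Lemma sum_gap_linear (t : 'I_n -> 'I_n * 'I_n) (k : R) b b' :
  \sum_u gap (k *: b + b') u (t u) = k * (\sum_u gap b u (t u)) + \sum_u gap b' u (t u).
Proof. by rewrite mulr_sumr -big_split; apply: eq_bigr => u _; rewrite gap_linear. Qed.

Lemma imform_linear a t i (k : R) b b' :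
  imform a t i (k *: b + b') = k * imform a t i b + imform a t i b'.
Proof.
case: i => [[u s]|[i|i]] /=; first by rewrite dotDr dotZr; ring.
  by rewrite lift_linear sum_gap_linear dotDr dotZr; ring.
case: ifP => _; last by rewrite mulr0 addr0.
by rewrite lift_linear sum_gap_linear dotDr dotZr; ring.
Qed.

Lemma imformP a t b : (forall i, imrhs a i <= imform a t i b) <->
  [/\ Lspace R n b,
      forall i, prhs i * (\sum_u gap b u (t u) - 1) <= dot (pnormal i) (lift t b) &
      forall i, dot (pnormal i) a = prhs i ->
        dot (pnormal i) (lift t b) = prhs i * (\sum_u gap b u (t u) - 1)].
Proof.
split=> [h|[Lb h1 h2] [[u s]|[i|i]] /=].
- have h1 i : prhs i * (\sum_u gap b u (t u) - 1) <= dot (pnormal i) (lift t b).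
    by have := h (inr (inl i)); rewrite /= mulrBr mulr1; lra.
  split=> // [u|i ti].
    have := h (inl (u, false)); have := h (inl (u, true)).
    by rewrite /= expr0 expr1 mul1r mulN1r; lra.
  apply/eqP; rewrite eq_le h1 andbT.
  by have := h (inr (inr i)); rewrite /= ti eqxx mulrBr mulr1; lra.
- by rewrite Lb mulr0.
- by have := h1 i; rewrite mulrBr mulr1; lra.
- by case: eqP => // /h2 ->; rewrite mulrBr mulr1; lra.
Qed.

Lemma polar_inv_lift t b : STSP_domain b -> (forall u, mu b u = gap b u (t u)) ->
  lift t b = (\sum_u gap b u (t u) - 1) *: polar_inv b /\ 0 < \sum_u gap b u (t u) - 1.
Proof.
move=> Bb mE; have b0 := STSP_domain_beta hn Bb.
have sE : \sum_u gap b u (t u) = \sum_u mu b u by apply: eq_bigr => u _; rewrite mE.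
rewrite sE; split=> //; rewrite /polar_inv scalerA divff ?scale1r ?gt_eqF//.
by rewrite /lift; congr (_ + _); apply: dsumE => u; rewrite mE.
Qed.

Lemma image_tight_faceE a t : GTSP_domain a ->
  (forall u, triangle u (t u)) ->
  (forall u, ev a (t u).1 (t u).2 = ev a u (t u).1 + ev a u (t u).2) ->
  [set polar_map y | y in tight_face a] = [set b | forall i, imrhs a i <= imform a t i b].
Proof.
move=> Aa tt tE; have [Pa sa _] := Aa.
apply/seteqP; split=> [_ [y ay <-]|b].
  have Ay := deletion_GTSP_domain hn (tight_face_deletion hn Aa) ay.
  have [Py ly] := (tight_faceP hn y Pa sa).1 ay.
  have By := GTSP_domain_polar_map hn Ay; have yE := polar_inv_polar_map hn Ay.
  have mE u : mu (polar_map y) u = gap (polar_map y) u (t u).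
    have [mg _] := TT_add_mu hn (polar_map y).
    apply: (tight_mu hn mg (tt u) _).2.
    have b0 := STSP_domain_beta hn By.
    have E v w : ev (polar_map y + dsum (mu (polar_map y))) v w =
        (\sum_u mu (polar_map y) u - 1) * ev y v w.
      by rewrite -[X in _ * ev X _ _]yE /polar_inv evZ mulrA divff ?mul1r// gt_eqF.
    by rewrite !E -mulrDr (tight_tight_le sa ly (tt u) (tE u)).
  have [lE l0] := polar_inv_lift By mE; rewrite yE in lE.
  have [Lb _ _] := By; apply/imformP; split=> // i.
    rewrite lE dotZr mulrC ler_pM2l//.
    by have : hpoly pnormal prhs y by rewrite -hpoly_GTSP_polar.
  by case: ay => _ ty ti; rewrite lE dotZr ty// mulrC.
move=> /imformP[Lb h1 h2].
set s := \sum_u gap b u (t u) - 1 in h1 h2.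
have c0 e : 0 <= coord (lift t b) e.
  by have := h1 (inl e); rewrite /= mul0r dotC dot_mvec1.
have s_tight m : good m -> dot a (mvec m) = 1 ->
    dot (lift t b) (mvec (reduce m)) = s.
  move=> gm tm; have [i [iE rE]] := pidx_reduce (R := R) gm.
  by have := h2 i; rewrite iE rE mul1r !(dotC (mvec _)); apply; exact: reduce_tight.
(* The weak inequalities already force this. The value [s] of the nonnegative [lift t b] on reduced
   tight multigraphs is at least 0; were it 0, [lift t b] would vanish since tight multigraphs use
   every edge, so [b] and its gaps would be 0 and [s = -1]. *)
have s0 : 0 < s.
  have [e0 _] := good_edge hn1 (hamilton_good hn2 (@hamilton_enum n)).
  have [m0 [gm0 tm0 _]] := sa e0.
  have s_ge0 : 0 <= s.
    by rewrite -(s_tight _ gm0 tm0) dot_mvec sumr_ge0// => e _; rewrite mulr_ge0.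
  rewrite lt_def s_ge0 andbT; apply/eqP => s0.
  have l0 : lift t b = 0.
    apply: coord_ext => e; have [m [gm tm me]] := sa e.
    have /eqP := s_tight _ gm tm; rewrite s0 dot_mvec.
    rewrite psumr_eq0 => [/allP/(_ e (mem_index_enum _))|f _]; last by rewrite mulr_ge0.
    rewrite /= mulf_eq0 pnatr_eq0 gtn_eqF ?reduce_gt0// orbF => /eqP ->.
    by rewrite /coord mxE.
  have bE : b = dsum (fun u => -1 * gap b u (t u)).
    by rewrite dsumZ scaleN1r; apply/eqP; rewrite -subr_eq0 opprK; apply/eqP.
  have b0 : b = 0 by rewrite bE; apply: Lspace_dsum_eq0; rewrite -bE.
  have g0 : \sum_u gap b u (t u) = 0.
    apply: big1 => u _; have := gap_linear u (t u) 1 b b.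
    by rewrite b0 scaler0 addr0 mul1r; lra.
  by move: s0; rewrite /s g0; lra.
have sn0 : s != 0 by rewrite gt_eqF.
exists (s^-1 *: lift t b).
  split=> i.
    by rewrite dotZr mulrC ler_pdivlMr//; exact: h1.
  by move=> /h2 h; rewrite dotZr h mulrC mulfK.
have zE : dot (s^-1 *: lift t b) (zpoint R n) - 1 = s^-1.
  rewrite dotZl dotDl (Lspace_z Lb) add0r dot_dsum_z//.
  have -> : \sum_u gap b u (t u) = s + 1 by rewrite /s subrK.
  by field.
have lE : s^-1 *: lift t b = s^-1 *: b + dsum (fun u => s^-1 * gap b u (t u)).
  by rewrite /lift scalerDr -dsumZ.
rewrite /polar_map zE invrK lE Lproj_add_dsum//; last first.
  by move=> u; rewrite dotZr Lb mulr0.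
by rewrite scalerA divff// scale1r.
Qed.

Lemma polyhedron_image_tight_face a : GTSP_domain a ->
  polyhedron [set polar_map y | y in tight_face a].
Proof.
move=> Aa; have [_ ta] := GTSP_domain_TT hn Aa.
have [t ht] := choice (fun u => let: ex_intro2 p h1 h2 := ta u in ex_intro _ p (conj h1 h2)).
rewrite (@image_tight_faceE a t)// => [|u|u]; [|exact: (ht u).1|exact: (ht u).2].
by apply: polyhedron_linear => i k x y; exact: imform_linear.
Qed.

(** The image contains the cell and is closed, being a polyhedron; hence it contains the closure. *)
Lemma image_tight_face a : GTSP_domain a ->
  [set polar_map y | y in tight_face a] = closure (rotation_cell (polar_map a)).
Proof.
move=> Aa; apply/seteqP; split; first exact: tight_face_subset_closure.
rewrite [X in _ `<=` X](closure_id _).1; last first.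
  by apply: closed_polyhedron; exact: polyhedron_image_tight_face.
by apply: closure_subset; exact: rotation_cell_subset.
Qed.

Lemma deletion_tight_face F : GTSP_deletion R n F -> F !=set0 ->
  exists2 a, GTSP_domain a & F = tight_face a.
Proof.
move=> dF F0; have [[fF _] _] := dF; rewrite hpoly_GTSP_polar// in fF.
have [a [Fa FE]] := face_relint fF F0.
by exists a => //; exact: deletion_GTSP_domain dF Fa.
Qed.

Lemma polyhedron_set0 d : polyhedron (set0 : set 'rV[R]_d).
Proof.
exists 1%N, (fun=> 0), (fun=> 1); apply/seteqP; split=> x //= /(_ ord0).
by rewrite dot0l ler10.
Qed.

End Images.

Theorem theorem3p3 (R : realType) (n : nat) (hn : (5 <= n)%N) :
  exists pi : edge_space R n -> edge_space R n,
    [/\ projective_on (carrier (GTSP_deletion R n)) pi,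
        homeomorphism_on (carrier (GTSP_deletion R n))
          (carrier (STSP_deletion R n)) pi
      & induces_comb_equiv pi (GTSP_deletion R n) (rotation_complex R n)].
Proof.
have cA := carrier_GTSP_deletion (R := R) hn; have cB := carrier_STSP_deletion (R := R) hn.
exists (@polar_map R n); split.
- pose f01 (x : edge_space R n) : R := dot x (zpoint R n).
  have l01 : scalar f01 by move=> k x y; rewrite /f01 dotDl dotZl.
  have l11 : linear (@Lproj R n) by move=> k x y; exact: Lproj_linear.
  pose F01 := HB.pack_for {scalar (edge_space R n)} f01
    (GRing.isLinear.Build R (edge_space R n) R *%R f01 l01).
  pose F11 := HB.pack_for {linear (edge_space R n) -> (edge_space R n)} (@Lproj R n)
    (GRing.isLinear.Build R _ _ *:%R (@Lproj R n) l11).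
  exists (-1), F01, 0, F11 => a /cA Aa; rewrite /= add0r addrC; split=> //.
  by rewrite subr_eq0 gt_eqF// GTSP_domain_dot_z.
- split.
  + split=> [a /cA Aa|a b /set_mem/cA Aa /set_mem/cA Ab E|b /cB Bb].
    * by apply/cB; exact: GTSP_domain_polar_map.
    * by rewrite -(polar_inv_polar_map hn Aa) E polar_inv_polar_map.
    * by exists (polar_inv b); [apply/cA; exact: STSP_domain_polar_inv|exact: polar_map_polar_inv].
  + apply: continuous_in_subspaceT => a /set_mem/cA Aa.
    exact: polar_map_continuous.
  exists (@polar_inv R n); split=> [a /set_mem/cA Aa|]; first exact: polar_inv_polar_map.
  apply: continuous_in_subspaceT => b /set_mem/cB Bb.
  exact: polar_inv_continuous.
split=> [F dF|].
  have [->|/set0P F0] := eqVneq F set0; first by rewrite image_set0; exact: polyhedron_set0.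
  have [a Aa ->] := deletion_tight_face hn dF F0.
  exact: polyhedron_image_tight_face.
apply/seteqP; split=> D [].
  move=> [F dF <-] D0; split=> //.
  have F0 : F !=set0.
    by apply/set0P/eqP => F0; apply: D0; rewrite F0 /= image_set0.
  have [a Aa ->] := deletion_tight_face hn dF F0.
  exists (polar_map a); first by apply/cB; exact: GTSP_domain_polar_map.
  by rewrite image_tight_face.
move=> [b /cB Bb <-] D0; split=> //.
exists (tight_face (polar_inv b)).
  by apply: tight_face_deletion => //; exact: STSP_domain_polar_inv.
by rewrite image_tight_face ?polar_map_polar_inv//; exact: STSP_domain_polar_inv.
Qed.
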